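(* Let $(\Omega,\mathbb{P},\mathcal{F})$ be a probability space, and let $\{\mathcal{F}^{-}_t\}_{t\ge 0}$ and $\{\mathcal{F}^{+}_t\}_{t\geq 0}$ (indexed by real $t\ge 0$) be two families of $\sigma$-algebras on $\Omega$ such that for all $t\ge s\ge 0$, $$\mathcal{F}^{-}_s\subseteq\mathcal{F}^{-}_{t}\subseteq \mathcal{F} \qquad\text{and}\qquad \mathcal{F}\supseteq \mathcal{F}^{+}_{s}\supseteq\mathcal{F}^{+}_{t}.$$ For any real $t\ge 0$ and integers $n>m\geq 0$, let $X_{m,n}^t:\Omega\to [0,\infty)$ be a random variable. Let there be $C\ge 0$ such that the following statements hold for all such $t,m,n$. (1) $X_{m,n}^t \leq X_{m,k}^t+X_{k,n}^{t+X_{m,k}^t}$ for all $k\in\{m+1,\dots,n-1\}$; (2) $\mathbb{E}[X_{0,1}^0]<\infty$; (3) the joint distribution of $\{X_{m,m+1}^t, X_{m,m+2}^t, \dots \}$ is independent of $(t,m)$; (4) $X_{m,n}^t$ is $\mathcal{F}^+_t$-measurable, and $\{\omega\in\Omega\,|\, X_{m,n}^t(\omega)\le s\}\in \mathcal{F}^{-}_{t+s}$ for any $s\ge 0$; (5) $\mathcal{F}^{-}_t$ and $\mathcal{F}_{t+C}^+$ are independent; (6) $X_{m,n}^t \leq X_{m,n}^{t+s}+s$ for all $s\in [C,C+c]$, with some $c>0$ (independent of $t,m,n$). Then, almost surely, $$\lim_{n\to \infty}\frac{X_{0,n}^0 }{n}= \lim_{n\to \infty}\frac{\mathbb{E}[X_{0,n}^0]}{n}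 = \inf_{n\ge 1}\frac{\mathbb{E}[ X_{0,n}^0 ]+C}{n}$$ (in particular, both limits exist). Moreover, if $C\in\mathbb{N}$ and all the $X_{m,n}^t$ are integer-valued, then the same conclusion holds when (6) is only assumed with $c=0$ (that is, only for $s=C$).
   Context: $\mathbb{N}=\{1,2,\dots\}$. The notation $X_{k,n}^{t+X_{m,k}^t}$ denotes the function $\omega\mapsto X_{k,n}^{t+X_{m,k}^t(\omega)}(\omega)$. *)

(* Defs.v *)
From mathcomp Require Export all_boot all_order all_algebra.
From mathcomp Require Export all_classical all_reals all_analysis.

Set Implicit Arguments.
Unset Strict Implicit.
Unset Printing Implicit Defensive.

Export Order.TTheory GRing.Theory Num.Theory.
Export numFieldNormedType.Exports.

Local Open Scope classical_set_scope.
Local Open Scope ring_scope.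

Definition measurable_wrt (R : realType) (T : Type) (G : set (set T))
    (f : T -> R) : Prop :=
  forall B : set R, measurable B -> G (f @^-1` B).

Definition indep_sigma_algebras (d : measure_display) (T : measurableType d)
    (R : realType) (P : probability T R) (G H : set (set T)) : Prop :=
  forall A B, G A -> H B -> P (A `&` B) = (P A * P B)%E.

(* Product sigma-algebra on R^N, generated by the coordinate maps. *)
Definition sequence_sigma_algebra (R : realType) : set (set (nat -> R)) :=
  <<s \bigcup_(i : nat)
        preimage_set_system [set: nat -> R] (fun u => u i) (@measurable _ R) >>.

(* Equality of the laws on R^N, i.e. of the joint distributions of all
   the coordinates of two random sequences. *)
Definition same_joint_distribution (d : measure_display)
    (T : measurableType d) (R : realType) (P : probability T R)
    (Y Z : T -> nat -> R) : Prop :=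
  forall A, sequence_sigma_algebra A -> P (Y @^-1` A) = P (Z @^-1` A).

Definition time_shift_bound (R : realType) (T : Type)
    (X : R -> nat -> nat -> T -> R) (C c : R) : Prop :=
  forall (t s : R) (m n : nat) (w : T), 0 <= t -> (m < n)%N ->
    C <= s <= C + c -> X t m n w <= X (t + s) m n w + s.

(* Expectations live in \bar R; that the common value l is real makes both
   limits finite, and the terms of index n = 0 are irrelevant to them. *)
Definition limit_conclusion (d : measure_display) (T : measurableType d)
    (R : realType) (P : probability T R) (Y : nat -> T -> R) (C : R) : Prop :=
  exists l : R,
    [/\ {ae P, forall w, Y n w / n%:R @[n --> \oo] --> l},
        ('E_P[Y n] * (n%:R^-1)%:E)%E @[n --> \oo] --> l%:E
      & l%:E = ereal_inf [set (('E_P[Y n] + C%:E) * (n%:R^-1)%:E)%E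
                         | n in [set n : nat | (1 <= n)%N]]].

(* Main.v *)
Require Import Defs.
From mathcomp Require Import measurable_realfun zify ring lra.

(** Why the limits exist.

    Restarting.  Passage times are rounded up to a lattice of mesh h, and the
    lag C is added to each of them once and for all.  The result is a family Y
    of passage times with values in nat which is subadditive without any
    correction term, and such that what happens before time i is independent of
    the passages that start at time i.  A departure delayed by a multiple of some
    period p never leads to an earlier arrival, so a passage that has reached
    position n may be restarted from there at any later time rho that is decided
    by the past, in the same residue class mod p ([restart_passage]).  The
    restarted passages form a copy of the initial ones that is independent of
    the past ([indep_at_random_time]).  Restarting at the arrival time itself
    makes the means subadditive, so they have a rate l ([subadditive_rate]).

    Doubling.  By restarting half-way, Y at 2m is at most a sum of two
    independent copies of Y at m.  For a convex nondecreasing phi, the mean of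
    phi (U_k), with U_k the passage time to 2 ^ k divided by 2 ^ k, is then
    nonincreasing in k, and drops at each step by at least the defect of
    convexity.  The hinges phi x = max (x - a, 0) need a first moment only, and
    their defect is at least e / 2 times P (U_k <= a - e) P (U_k >= a + e); so
    the series of these products converges ([doubling_summable]).  The mean of
    U_k tends to l from above, so for a slightly below or above l one of the two
    factors stays away from 0, and the other one has a convergent series
    ([lower_tail_summable], [upper_tail_summable]).  This plays the role of the
    variance estimate of Kesten and Hammersley, which needs second moments.

    Between powers of 2.  If Y_n <= (l - x) n for some n in [m, 2m[, restart at
    the first such n: the rest of the way to 2m is not too long with probability
    bounded below, so Y_2m is abnormally small with a probability comparable to
    that of the initial event ([early_arrival]), and Borel-Cantelli gives the
    lower bound ([liminf_passage]).  For the upper bound, compare n with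
    r 2 ^ k, where r 2 ^ k <= n < (r + 1) 2 ^ k: the extra cost is at most a copy
    of the running maximum of Y up to 2 ^ k.  The running maximum doubles like Y
    itself, provided that one restarts after the maximum has been attained
    ([peak_doubling]); hence it is O (2 ^ k), which is negligible for large r
    ([limsup_passage]).

    Back to X.  As X + C <= h Y <= X + C + h, the process X has the rate h l,
    which is the same for all admissible h; letting h tend to 0 in
    h l n <= E[X_n] + C + h gives the infimum.  In the integer case h = 1 and
    rounding costs nothing. *)

Set Implicit Arguments.
Unset Strict Implicit.
Unset Printing Implicit Defensive.

Local Open Scope classical_set_scope.
Local Open Scope ring_scope.

(** * Natural-valued random variables *)

Definition scaled {R : realType} (k n : nat) : R := n%:R / 2 ^+ k.

Definition excess {R : realType} (a x : R) : R := Num.max (x - a) 0.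

Lemma scaled_ge0 {R : realType} k n : 0 <= scaled k n :> R.
Proof. by rewrite /scaled divr_ge0// exprn_ge0. Qed.

Section nat_rv.
Context (d : measure_display) (T : measurableType d) (R : realType).
Context (P : probability T R).

Lemma measurable_nat_comp (V : T -> nat) (f : nat -> R) :
  measurable_fun setT V -> measurable_fun setT (f \o V).
Proof. by move=> mV; apply: measurableT_comp => //; move=> _ Y mY. Qed.

Lemma measurable_nat_preimage (V : T -> nat) (A : set nat) :
  measurable_fun setT V -> measurable (V @^-1` A).
Proof. by move=> mV; rewrite -[_ @^-1` _]setTI; apply: mV. Qed.

Lemma eq_integral_law (V W : T -> nat) (f : nat -> R) :
    measurable_fun setT V -> measurable_fun setT W -> (forall k, 0 <= f k) ->
    (forall A, P (V @^-1` A) = P (W @^-1` A)) ->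
  (\int[P]_w (f (V w))%:E = \int[P]_w (f (W w))%:E)%E.
Proof.
move=> mV mW f0 VW.
have mf : measurable_fun setT (EFin \o f : nat -> \bar R) by move=> _ Y mY.
have fp k : k \in [set: nat] -> (0 <= (EFin \o f) k)%E by rewrite /= lee_fin.
have := @ge0_integral_pushforward _ _ T nat R V mV P setT (EFin \o f) measurableT mf fp.
have := @ge0_integral_pushforward _ _ T nat R W mW P setT (EFin \o f) measurableT mf fp.
rewrite !preimage_setT => <- <-.
by apply: eq_measure_integral => A mA _; exact: VW.
Qed.

Lemma measurable_bigmax_nat (I : Type) (s : seq I) (f : I -> T -> nat) :
  (forall i, measurable_fun setT (f i)) ->
  measurable_fun setT (fun w => \max_(i <- s) f i w)%N.
Proof.
move=> mf; elim: s => [|i s IHs].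
  by rewrite (_ : (fun w => _) = cst 0%N)//; apply/funext => w; rewrite big_nil.
rewrite (_ : (fun w => _) = (fun w => maxn (f i w) (\max_(i <- s) f i w))%N).
  exact: measurable_fun_maxn.
by apply/funext => w; rewrite big_cons.
Qed.

Definition mean (V : T -> nat) (f : nat -> R) : \bar R :=
  (\int[P]_w (f (V w))%:E)%E.

Lemma measurable_nat_EFin (V : T -> nat) (f : nat -> R) :
  measurable_fun setT V -> measurable_fun setT (fun w => (f (V w))%:E).
Proof. by move=> mV; apply/measurable_EFinP; exact: measurable_nat_comp. Qed.

Lemma meanD (V : T -> nat) (f g : nat -> R) : measurable_fun setT V ->
    (forall n, 0 <= f n) -> (forall n, 0 <= g n) ->
  mean V (fun n => f n + g n) = (mean V f + mean V g)%E.
Proof.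
move=> mV f0 g0; rewrite /mean -ge0_integralD//.
all: by [move=> w _; rewrite lee_fin|exact: measurable_nat_EFin].
Qed.

Lemma meanZ (V : T -> nat) (f : nat -> R) (r : R) : measurable_fun setT V ->
    (forall n, 0 <= f n) -> 0 <= r ->
  mean V (fun n => r * f n) = (r%:E * mean V f)%E.
Proof.
move=> mV f0 r0; rewrite /mean -ge0_integralZl_EFin//.
all: by [move=> w _; rewrite lee_fin|exact: measurable_nat_EFin].
Qed.

Lemma mean_le (V : T -> nat) (f g : nat -> R) : measurable_fun setT V ->
    (forall n, 0 <= f n) -> (forall n, f n <= g n) -> (mean V f <= mean V g)%E.
Proof.
move=> mV f0 fg; apply: ge0_le_integral => //.
all: try (by move=> w _; rewrite lee_fin).
all: exact: measurable_nat_EFin.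
Qed.

Lemma mean_ge0 (V : T -> nat) (f : nat -> R) : (forall n, 0 <= f n) ->
  (0 <= mean V f)%E.
Proof. by move=> f0; apply: integral_ge0 => w _; rewrite lee_fin. Qed.

Lemma mean_cst (V : T -> nat) (r : R) : mean V (fun=> r) = r%:E.
Proof. by rewrite /mean integral_cst//= probability_setT mule1. Qed.

Lemma mean_pred (V : T -> nat) (p : pred nat) : measurable_fun setT V ->
  mean V (fun n => (p n)%:R) = P [set w | p (V w)].
Proof.
move=> mV; have mp : measurable [set w | p (V w)].
  exact: (measurable_nat_preimage [set n | p n] mV).
rewrite -[[set w | p (V w)]]setIT -integral_indic//; apply: eq_integral => w _.
rewrite indicE; congr (_%:R%:E); case: (boolP (p (V w))) => h.
  by rewrite mem_set.
by rewrite memNset //=; apply/negP.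
Qed.

(** The variable is integrable, so dominated convergence applies.  The bound is
    meant for the initial scale; [doubling_excess_le] carries it to all scales,
    which makes the rescaled variables uniformly integrable. *)
Lemma mean_excess_small (V : T -> nat) (e : R) : measurable_fun setT V ->
    (mean V (fun n => n%:R) < +oo)%E -> 0 < e ->
  exists2 B : R, 0 <= B & (mean V (fun n => excess B n%:R) <= e%:E)%E.
Proof.
move=> mV fV e0.
pose f (N : nat) w := (excess N%:R (V w)%:R : R)%:E.
have mf N : measurable_fun setT (f N).
  exact: (measurable_nat_EFin (fun n => excess N%:R n%:R)).
have /fine_cvgP[_] : (\int[P]_w f N w)%E @[N --> \oo] --> 0%:E.
  rewrite [X in _ --> X](_ : _ = (\int[P]_w cst 0%E w)%E); last first.
    by rewrite integral0.
  apply: (@dominated_cvg _ _ _ P setT measurableT f _ (fun w => (V w)%:R%:E)) => //.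
  - move=> w _; apply: cvg_near_cst; exists (V w) => // N /= VN.
    by rewrite /f /excess; congr EFin; apply/max_idPr; rewrite subr_le0 ler_nat.
  - apply/integrableP; split; first exact: (measurable_nat_EFin (fun n => n%:R)).
    by under eq_integral do rewrite gee0_abs ?lee_fin//.
  - move=> N w _; rewrite /f /excess gee0_abs ?lee_fin ?le_max ?lexx ?orbT//.
    by rewrite ge_max ler0n andbT lerBlDr lerDl.
move=> /cvgrPdist_lt /(_ e e0)[N _ /(_ N (leqnn N))] /=.
rewrite sub0r normrN => lt_e; exists N%:R => //.
have fin : (mean V (fun n => excess N%:R n%:R) \is a fin_num)%E.
  rewrite ge0_fin_numE; last by apply: mean_ge0 => n; rewrite /excess le_max lexx orbT.
  apply: le_lt_trans fV; apply: mean_le => // n; rewrite /excess ?le_max ?lexx ?orbT//.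
  by rewrite ge_max ler0n andbT lerBlDr lerDl.
rewrite -(fineK fin) lee_fin; apply: ltW; apply: le_lt_trans lt_e.
exact: ler_norm.
Qed.

End nat_rv.

Lemma mean_natD (d : measure_display) (T : measurableType d) (R : realType)
    (P : probability T R) (U V W : T -> nat) :
    measurable_fun setT U -> measurable_fun setT V -> measurable_fun setT W ->
    (forall w, (U w <= V w + W w)%N) ->
  (mean P U (fun n => n%:R) <= mean P V (fun n => n%:R) + mean P W (fun n => n%:R))%E.
Proof.
move=> mU mV mW UVW.
have mn X : measurable_fun setT X -> measurable_fun setT (fun w : T => ((X w)%:R : R)%:E).
  exact: (measurable_nat_EFin (fun n => n%:R)).
rewrite /mean -ge0_integralD//; [|exact: mn|exact: mn].
apply: ge0_le_integral => //; [exact: mn|exact: emeasurable_funD (mn _ mV) (mn _ mW)|].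
by move=> w _; rewrite -EFinD lee_fin -natrD ler_nat.
Qed.

(** * Convergent series of probabilities *)

Section nneseries_bounds.
Context {R : realType}.
Implicit Types (u p q : nat -> \bar R).

Lemma nneseries_le_bound u M : (forall k, (0 <= u k)%E) ->
  (forall n, (\sum_(0 <= k < n) u k <= M)%E) -> (\sum_(0 <= k <oo) u k <= M)%E.
Proof.
move=> u0 uM; apply: lime_le; first by apply: is_cvg_nneseries => k _ _; exact: u0.
exact: nearW.
Qed.

Lemma nneseries_weight_bounded_below p q (b : R) k0 : 0 < b ->
    (forall k, (0 <= p k <= 1)%E) -> (forall k, (0 <= q k)%E) ->
    (forall k, (k0 <= k)%N -> (b%:E <= q k)%E) ->
    (\sum_(0 <= k <oo) (p k * q k) < +oo)%E ->
  (\sum_(0 <= k <oo) p k < +oo)%E.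
Proof.
move=> b0 p01 q0 bq Spq; set S := (limn _) in Spq.
have p0 k : (0 <= p k)%E by have /andP[] := p01 k.
have S0 : (0 <= S)%E by apply: nneseries_ge0 => k _ _; rewrite mule_ge0.
have finS : S \is a fin_num by rewrite ge0_fin_numE.
apply: (@le_lt_trans _ _ (b^-1%:E * S + k0%:R%:E)%E); last first.
  by rewrite -(fineK finS) -EFinM -EFinD ltry.
apply: nneseries_le_bound => // n.
have step k : (p k <= b^-1%:E * (p k * q k) + ((k < k0)%N%:R : R)%:E)%E.
  case: ltnP => [kk0|k0k]; last first.
    rewrite adde0 lee_pdivlMl// muleC lee_wpmul2l//; exact: bq.
  have /andP[_ p1] := p01 k; apply: le_trans p1 _.
  by rewrite leeDr// mule_ge0 ?mule_ge0// lee_fin invr_ge0 ltW.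
apply: le_trans (lee_sum _ (fun k _ => step k)) _; rewrite big_split/=.
apply: leeD.
  rewrite -ge0_sume_distrr//; last by move=> k _; rewrite mule_ge0.
  rewrite lee_wpmul2l// ?lee_fin ?invr_ge0 ?(ltW b0)//.
  by apply: nneseries_lim_ge => k _ _; rewrite mule_ge0.
rewrite sumEFin lee_fin -natr_sum ler_nat.
suff : (\sum_(0 <= k < n) (k < k0) <= minn n k0)%N.
  by move=> /leq_trans; apply; rewrite geq_minr.
elim: n => [|n IHn]; first by rewrite big_geq.
rewrite big_nat_recr//=; case: ltnP => nk; first by move: IHn; rewrite !minnE; lia.
by move: IHn; rewrite !minnE; lia.
Qed.

Lemma ae_eventually_not (d : measure_display) (T : measurableType d)
    (P : probability T R) (F : nat -> set T) : (forall k, measurable (F k)) ->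
    (\sum_(0 <= k <oo) P (F k) < +oo)%E ->
  {ae P, forall w, exists k0, forall k, (k0 <= k)%N -> ~ F k w}.
Proof.
move=> mF SF; exists (lim_sup_set F); split.
- by apply: bigcapT_measurable => n; exact: bigcup_measurable.
- exact: lim_sup_set_cvg0.
move=> w /= h n _; apply: contrapT => nF; apply: h; exists n => k nk Fk.
by apply: nF; exists k.
Qed.

End nneseries_bounds.

(** * Sequences that double independently *)

(** [W k] is an independent copy of [V k], and [V k.+1] is at most their sum.
    Tails refer to [V k] divided by [2 ^ k]. *)
Section doubling.
Context (d : measure_display) (T : measurableType d) (R : realType).
Context (P : probability T R) (V W : nat -> T -> nat).
Context (mV : forall k, measurable_fun setT (V k)).
Context (mW : forall k, measurable_fun setT (W k)).
Context (lawW : forall k A, P (W k @^-1` A) = P (V k @^-1` A)).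
Context (indVW : forall k A B,
  P (V k @^-1` A `&` W k @^-1` B) = (P (V k @^-1` A) * P (V k @^-1` B))%E).
Context (leVW : forall k w, (V k.+1 w <= V k w + W k w)%N).

Local Notation lower k a := [set w | scaled k (V k w) <= a :> R].
Local Notation upper k a := [set w | a <= scaled k (V k w) :> R].

(** The hinge at [a] is affine on each side of [a], so its defect of convexity
    between two points on opposite sides is half the distance from [a] to the
    nearer one. *)
Lemma excess_midpoint (a e x y : R) : 0 <= e ->
  excess a ((x + y) / 2) + e / 2 * ((x <= a - e) && (a + e <= y))%:R
  <= 2^-1 * excess a x + 2^-1 * excess a y.
Proof.
move=> e0; rewrite /excess.
case: (leP x (a - e)) => /= h1; case: (leP (a + e) y) => /= h2;
rewrite ?maxEle;
do ?case: ifPn; rewrite -?ltNge => *; lra.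
Qed.

(** Jensen at the midpoint of [V k] and [W k], keeping the defect of convexity on
    the event where the two variables are on opposite sides of [a]; independence
    makes the probability of that event a product. *)
Lemma doubling_gap k (a e : R) : 0 <= e ->
  (mean P (V k.+1) (excess a \o scaled k.+1)
     + (e / 2)%:E * (P (lower k (a - e)%R) * P (upper k (a + e)%R))
   <= mean P (V k) (excess a \o scaled k))%E.
Proof.
move=> e0; rewrite /mean /=.
have ex0 x : 0 <= excess a x by rewrite /excess le_max lexx orbT.
pose B := V k @^-1` [set n | scaled k n <= a - e]
  `&` W k @^-1` [set n | a + e <= scaled k n].
have mB : measurable B by apply: measurableI; exact: measurable_nat_preimage.
have PB : P B = (P (lower k (a - e)%R) * P (upper k (a + e)%R))%E by rewrite indVW.
rewrite -PB -[B]setIT -integral_indic// -ge0_integralZl_EFin//; last 2 first.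
- exact/measurable_EFinP.
- by rewrite divr_ge0.
rewrite -ge0_integralD//; last 3 first.
- exact: (measurable_nat_EFin (fun n => excess a (scaled k.+1 n))).
- by move=> w _; rewrite -EFinM lee_fin mulr_ge0// divr_ge0.
- by apply: measurable_funeM; exact/measurable_EFinP.
have half2 : (\int[P]_w (excess a (scaled k (V k w)))%:E =
  \int[P]_w (2^-1%:E * (excess a (scaled k (V k w)))%:E
           + 2^-1%:E * (excess a (scaled k (W k w)))%:E))%E.
  rewrite ge0_integralD//; last 4 first.
  - by move=> w _; rewrite -EFinM lee_fin mulr_ge0.
  - by apply: measurable_funeM; exact: (measurable_nat_EFin (fun n => excess a (scaled k n))).
  - by move=> w _; rewrite -EFinM lee_fin mulr_ge0.
  - by apply: measurable_funeM; exact: (measurable_nat_EFin (fun n => excess a (scaled k n))).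
  rewrite !ge0_integralZl_EFin//.
  - rewrite (eq_integral_law (mW k) (mV k) (f := fun n => excess a (scaled k n)))//.
    by rewrite -ge0_muleDl ?lee_fin// -EFinD -[2^-1]mul1r -splitr mul1e.
  - by move=> w _; rewrite lee_fin.
  - exact: (measurable_nat_EFin (fun n => excess a (scaled k n))).
  - by move=> w _; rewrite lee_fin.
  - exact: (measurable_nat_EFin (fun n => excess a (scaled k n))).
rewrite half2.
apply: ge0_le_integral => //.
- by move=> w _; rewrite -EFinM -EFinD lee_fin addr_ge0// mulr_ge0// divr_ge0.
- apply: emeasurable_funD; first exact: (measurable_nat_EFin (fun n => excess a (scaled k.+1 n))).
  by apply: measurable_funeM; exact/measurable_EFinP.
- apply: emeasurable_funD; apply: measurable_funeM;
  exact: (measurable_nat_EFin (fun n => excess a (scaled k n))).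
move=> w _; rewrite -!EFinM -!EFinD lee_fin.
apply: (@le_trans _ _ _ _ _ _ (@excess_midpoint a e _ _ e0)).
apply: lerD.
  have sub : scaled k.+1 (V k.+1 w) <= (scaled k (V k w) + scaled k (W k w)) / 2 :> R.
    have ip0 : 0 <= (2 ^+ k)^-1 :> R by rewrite invr_ge0 exprn_ge0.
    have VW : (V k.+1 w)%:R <= (V k w)%:R + (W k w)%:R :> R by rewrite -natrD ler_nat.
    have := ler_wpM2r ip0 VW; rewrite /scaled exprS invfM; lra.
  by rewrite /excess ge_max !le_max lexx orbT andbT lerB.
rewrite ler_wpM2l ?divr_ge0// /B indicE ler_nat.
case: (boolP (w \in _)) => //; rewrite inE => -[/= -> ->] //.
by move=> w _; rewrite lee_fin.
Qed.

Lemma doubling_excess_le k (a : R) :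
  (mean P (V k) (excess a \o scaled k) <= mean P (V 0) (excess a \o scaled 0))%E.
Proof.
elim: k => // k; apply: le_trans; apply: le_trans (doubling_gap k a (lexx 0)).
by rewrite mul0r mul0e adde0.
Qed.

(** The drops of the mean of the hinge telescope, and that mean is nonnegative. *)
Lemma doubling_summable (a e : R) : 0 < e -> (mean P (V 0) (fun n => n%:R) < +oo)%E ->
  (\sum_(0 <= k <oo) (P (lower k (a - e)%R) * P (upper k (a + e)%R)) < +oo)%E.
Proof.
move=> e0 V0.
have ex0 x : 0 <= excess a x by rewrite /excess le_max lexx orbT.
have m0 : (mean P (V 0) (excess a \o scaled 0) < +oo)%E.
  apply: (@le_lt_trans _ _ (mean P (V 0) (fun n => n%:R + `|a|))).
    apply: mean_le => // n /=; first exact: ex0.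
    rewrite /excess /scaled expr0 divr1.
    rewrite ge_max addr_ge0// andbT lerD2l.
    by rewrite (le_trans (ler_norm _))// normrN.
  by rewrite meanD// mean_cst lte_add_pinfty// ltry.
have fin : mean P (V 0) (excess a \o scaled 0) \is a fin_num.
  by rewrite ge0_fin_numE// mean_ge0//= => n; exact: ex0.
have e20 : 0 < e / 2 by rewrite divr_gt0.
have u0 k : (0 <= P (lower k (a - e)%R) * P (upper k (a + e)%R))%E by rewrite mule_ge0.
have tele n : (mean P (V n) (excess a \o scaled n) + (e / 2)%:E *
    \sum_(0 <= k < n) (P (lower k (a - e)%R) * P (upper k (a + e)%R))
    <= mean P (V 0) (excess a \o scaled 0))%E.
  elim: n => [|n IHn]; first by rewrite big_geq// mule0 adde0.
  apply: le_trans IHn; rewrite big_nat_recr//= ge0_muleDr//; last first.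
    by apply: sume_ge0.
  rewrite addeCA [leRHS]addeC leeD2l//.
  exact: (doubling_gap n a (ltW e0)).
apply: (@le_lt_trans _ _ ((e / 2)^-1%:E * mean P (V 0) (excess a \o scaled 0))%E); last first.
  by rewrite -(fineK fin) -EFinM ltry.
apply: nneseries_le_bound => // n.
rewrite lee_pdivlMl//; apply: le_trans (tele n).
by rewrite leeDr// mean_ge0//= => k; exact: ex0.
Qed.

Let P_fin (A : set T) : measurable A -> exists2 r : R, 0 <= r & P A = r%:E.
Proof.
move=> mA; exists (fine (P A)); first by rewrite fine_ge0.
by rewrite fineK// fin_num_measure.
Qed.

Let m_lower k a : measurable (lower k a).
Proof. exact: (measurable_nat_preimage [set n | scaled k n <= a]). Qed.

Let m_upper k a : measurable (upper k a).
Proof. exact: (measurable_nat_preimage [set n | a <= scaled k n]). Qed.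

(** If the rescaled means stay above [l], uniform integrability prevents the mass
    from staying below [l - e / 3]; then [doubling_summable] at [l - 2 / 3 e]
    bounds the series of the masses below [l - e]. *)
Lemma lower_tail_summable (l e : R) : 0 <= l -> 0 < e ->
    (mean P (V 0) (fun n => n%:R) < +oo)%E ->
    (forall k, (l%:E <= mean P (V k) (scaled k))%E) ->
  (\sum_(0 <= k <oo) P (lower k (l - e)%R) < +oo)%E.
Proof.
move=> l0 e0 V0 lV.
have e60 : 0 < e / 6 by rewrite divr_gt0.
have [B B0 VB] := mean_excess_small (mV 0) V0 e60.
have e30 : 0 < B + e / 3 by rewrite ltr_wpDl// divr_gt0.
have := doubling_summable (l - 2 / 3 * e) (e := e / 3) _ V0.
rewrite divr_gt0// => /(_ isT).
rewrite (_ : l - 2 / 3 * e - e / 3 = l - e); last by lra.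
rewrite (_ : l - 2 / 3 * e + e / 3 = l - e / 3); last by lra.
apply: (@nneseries_weight_bounded_below _ _ _ (e / 6 / (B + e / 3)) 0) => //.
- by rewrite divr_gt0.
- by move=> k; rewrite measure_ge0 probability_le1.
move=> k _.
have ex0 x : 0 <= excess B x by rewrite /excess le_max lexx orbT.
(* On [scaled k n < l - e / 3] the first term on the right suffices; elsewhere
   [scaled k n] is at most [B] plus its excess over [B].  The sign of [l] is used
   there. *)
have le1 : (mean P (V k) (fun n => (scaled k n + e / 3)%R) <= mean P (V k)
    (fun n => l + ((B + e / 3) * (l - e / 3 <= scaled k n)%R%:R
                   + excess B (scaled k n)))%R)%E.
  apply: mean_le => // n; first by rewrite addr_ge0// divr_ge0// ltW.
  rewrite /excess maxEle.
  by case: (leP (l - e / 3) (scaled k n)) => /= h1; case: ifPn; rewrite -?ltNge => h2; lra.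
have eB0 n : 0 <= (B + e / 3) * (l - e / 3 <= scaled k n)%R%:R.
  by rewrite mulr_ge0// ltW.
have s0 n : 0 <= scaled k n :> R := scaled_ge0 k n.
have e3_0 (n : nat) : 0 <= e / 3 by rewrite divr_ge0// ltW.
have eB1 n := addr_ge0 (eB0 n) (ex0 (scaled k n)).
move: le1; rewrite !meanD//.
rewrite !mean_cst meanZ//; last exact: ltW.
rewrite (mean_pred P (fun n => l - e / 3 <= scaled k n))//.
have [p p0 ep] := P_fin (m_upper k (l - e / 3)).
rewrite ep => le1.
have : ((l + e / 3)%:E <= (l + ((B + e / 3) * p + e / 6))%:E)%E.
  rewrite EFinD; apply: le_trans (leeD2r _ (lV k)) _; apply: le_trans le1 _.
  rewrite !EFinD EFinM leeD2l// leeD2l//.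
  apply: le_trans (doubling_excess_le k B) _; apply: le_trans VB.
  apply: mean_le => // n; first exact: ex0.
  by rewrite /= /scaled expr0 divr1.
rewrite !lee_fin ler_pdivrMr// [p * _]mulrC => h; clear e3_0; lra.
Qed.

(** By Markov's inequality a variable of mean at most [L] keeps a positive mass
    below [L + e / 3]; then [doubling_summable] applies at [L + 2 / 3 e]. *)
Lemma upper_tail_summable (L e : R) k0 : 0 <= L -> 0 < e ->
    (mean P (V 0) (fun n => n%:R) < +oo)%E ->
    (forall k, (k0 <= k)%N -> (mean P (V k) (scaled k) <= L%:E)%E) ->
  (\sum_(0 <= k <oo) P (upper k (L + e)%R) < +oo)%E.
Proof.
move=> L0 e0 V0 VL.
have e30 : 0 < L + e / 3 by rewrite ltr_wpDl// divr_gt0.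
have := doubling_summable (L + 2 / 3 * e) (e := e / 3) _ V0.
rewrite divr_gt0// => /(_ isT).
rewrite (_ : L + 2 / 3 * e - e / 3 = L + e / 3); last by lra.
rewrite (_ : L + 2 / 3 * e + e / 3 = L + e); last by lra.
rewrite (@eq_eseriesr _
  (fun k => P (lower k (L + e / 3)%R) * P (upper k (L + e)%R))%E
  (fun k => P (upper k (L + e)%R) * P (lower k (L + e / 3)%R))%E); last first.
  by move=> k _; rewrite muleC.
apply: (@nneseries_weight_bounded_below _ _ _ (e / 3 / (L + e / 3)) k0) => //.
- by rewrite !divr_gt0.
- by move=> k; rewrite measure_ge0 probability_le1.
move=> k k0k.
have le1 : (mean P (V k) (fun=> (L + e / 3)%R) <= mean P (V k)
    (fun n => scaled k n + (L + e / 3) * (scaled k n <= L + e / 3)%R%:R)%R)%E.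
  apply: mean_le => // n; first exact: ltW.
  have : 0 <= scaled k n :> R := scaled_ge0 k n.
  by case: (leP (scaled k n) (L + e / 3)) => /= h1 h2; lra.
have eB0 n : 0 <= (L + e / 3) * (scaled k n <= L + e / 3)%R%:R.
  by rewrite mulr_ge0// ltW.
have s0 n : 0 <= scaled k n :> R := scaled_ge0 k n.
move: le1; rewrite mean_cst meanD// meanZ//; last exact: ltW.
rewrite (mean_pred P (fun n => scaled k n <= L + e / 3))//.
have [p p0 ep] := P_fin (m_lower k (L + e / 3)).
rewrite ep => le1.
have : ((L + e / 3)%:E <= (L + (L + e / 3) * p)%:E)%E.
  by apply: le_trans le1 _; rewrite [leRHS]EFinD EFinM leeD2r// VL.
rewrite !lee_fin ler_pdivrMr// [p * _]mulrC => h; lra.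
Qed.

End doubling.

(** * Linear growth rates *)

(** Fekete's lemma, with an additive error [K] that is uniform in [n]: divide [n]
    by a [k] whose ratio [e k / k] is close to the infimum, and let [K] pay for
    the remainder. *)
Lemma subadditive_rate (R : realType) (e : nat -> R) :
    (forall n, 0 <= e n) -> (forall a b, e (a + b)%N <= e a + e b) ->
  exists l : R, [/\ 0 <= l, forall n, l * n%:R <= e n &
    forall x, 0 < x -> exists2 K, 0 <= K & forall n, e n <= (l + x) * n%:R + K].
Proof.
move=> e0 esub.
pose S := [set e n / n%:R | n in [set n : nat | (0 < n)%N]].
have lbS : lbound S 0 by move=> _ [n _ <-]; rewrite divr_ge0.
have infS : has_inf S by split; [exists (e 1 / 1%:R), 1%N|exists 0].
exists (inf S); split.
- by apply: lb_le_inf => //; case: infS.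
- move=> n; have [->|n0] := posnP n; first by rewrite mulr0.
  by rewrite -ler_pdivlMr ?ltr0n//; apply: ge_inf; [case: infS|exists n].
move=> x x0; have [_ [k /= k0 <-]] := inf_adherent x0 infS => ek.
exists (e 0%N + \sum_(r < k) e r); first by rewrite addr_ge0// sumr_ge0.
move=> n.
have emul q : e (q * k)%N <= q%:R * e k + e 0.
  elim: q => [|q IHq]; first by rewrite mul0n mul0r add0r.
  by rewrite mulSn (le_trans (esub _ _))// -[q.+1]add1n natrD mulrDl mul1r -addrA lerD2l.
have lx0 : 0 <= inf S + x by rewrite addr_ge0 ?(ltW x0)// lb_le_inf//; case: infS.
rewrite {1}(divn_eq n k) (le_trans (esub _ _))//.
apply: (le_trans (lerD (emul _) (lexx _))); rewrite -addrA lerD//.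
  have ekk : e k <= (inf S + x) * k%:R by rewrite -ler_pdivrMr ?ltr0n// ltW.
  apply: (le_trans (ler_wpM2l (ler0n _ _) ekk)).
  by rewrite mulrCA ler_wpM2l// -natrM ler_nat leq_trunc_div.
by rewrite lerD2l (bigD1 (Ordinal (ltn_pmod n k0)))//= lerDl sumr_ge0.
Qed.

Lemma cvg_rate (R : realType) (u : nat -> R) (l : R) :
  (forall x, 0 < x -> exists n0, forall n, (n0 <= n)%N ->
    (l - x) * n%:R <= u n <= (l + x) * n%:R) ->
  u n / n%:R @[n --> \oo] --> l.
Proof.
move=> ul; apply/cvgrPdist_le => x x0; have [n0 un] := ul x x0.
exists n0.+1 => // n /= nn; have /andP[ln nl] := un n (ltnW nn).
have n0R : 0 < n%:R :> R by rewrite ltr0n (leq_ltn_trans _ nn).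
by rewrite distrC ler_distl ler_pdivlMr// ler_pdivrMr// ln nl.
Qed.

Lemma cvg_rate_affine (R : realType) (u v : nat -> R) (h a b l : R) : 0 < h ->
    (forall n, (0 < n)%N -> v n + a <= h * u n <= v n + b) ->
    u n / n%:R @[n --> \oo] --> l ->
  v n / n%:R @[n --> \oo] --> h * l.
Proof.
move=> h0 uv /cvgrPdist_le ul; apply: cvg_rate => x x0.
have xh0 : 0 < x / 2 / h by rewrite !divr_gt0.
have [n0 _ un] := ul _ xh0.
exists (maxn n0 (Num.truncn ((`|a| + `|b|) / (x / 2))).+1) => n.
rewrite geq_max => /andP[/un /= + nab].
have nn : (0 < n)%N by apply: leq_trans nab.
have n0R : 0 < n%:R :> R by rewrite ltr0n.
have abn : `|a| + `|b| <= x / 2 * n%:R.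
  rewrite [leRHS]mulrC -ler_pdivrMr ?divr_gt0//; apply: ltW; apply: lt_le_trans (truncnS_gt _) _.
  by rewrite ler_nat.
rewrite distrC ler_distl ler_pdivlMr// ler_pdivrMr// => /andP[u1 u2].
have /andP[v1 v2] := uv n nn.
have {}u1 := ler_wpM2l (ltW h0) u1; have {}u2 := ler_wpM2l (ltW h0) u2.
have hx : h * (x / 2 / h) = x / 2 by rewrite mulrC divfK// gt_eqF.
have e1 : h * ((l - x / 2 / h) * n%:R) = (h * l - x / 2) * n%:R by rewrite -{2}hx; ring.
have e2 : h * ((l + x / 2 / h) * n%:R) = (h * l + x / 2) * n%:R by rewrite -{2}hx; ring.
rewrite e1 in u1; rewrite e2 in u2.
have := ler_norm a; have := ler_norm b; have := ler_norm (- a); have := ler_norm (- b).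
rewrite !normrN => ? ? ? ?.
have := normr_ge0 a; have := normr_ge0 b => ? ?.
by apply/andP; split; lra.
Qed.

(** Taking [r] between [r0] and [2 r0] leaves finitely many values of [r], so that
    countably many almost sure statements indexed by [r] give a common threshold
    on [k]. *)
Lemma dyadic_block (r0 K n : nat) : (0 < r0)%N -> (r0 * 2 ^ K <= n)%N ->
  exists r k, [/\ (r0 <= r < 2 * r0)%N, (K <= k)%N & (r * 2 ^ k <= n < r.+1 * 2 ^ k)%N].
Proof.
move=> r00 Kn.
have Kq : (2 ^ K <= n %/ r0)%N by rewrite leq_divRL// mulnC.
have q0 : (0 < n %/ r0)%N by apply: leq_trans Kq; rewrite expn_gt0.
pose k := trunc_log 2 (n %/ r0); exists (n %/ 2 ^ k)%N, k.
have /andP[k1 k2] := trunc_log_bounds (isT : 1 < 2)%N q0.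
have k0 : (0 < 2 ^ k)%N by rewrite expn_gt0.
split; last by rewrite leq_trunc_div ltn_ceil.
  move: k1 k2; rewrite !leq_divRL// !ltn_divLR// expnS -/k.
  by move: (2 ^ k)%N => N; nia.
exact: trunc_log_max.
Qed.

(** * Restarting a passage *)

(** The first time of the form [y + p * k] that is not before [b]. *)
Definition restart (p y b : nat) : nat := (y + p * ((b - y + p.-1) %/ p))%N.

Lemma restart_ge p y b : (y <= restart p y b)%N.
Proof. exact: leq_addr. Qed.

Lemma restart_ge_level p y b : (0 < p)%N -> (b <= restart p y b)%N.
Proof.
move=> p0; rewrite /restart.
have := divn_eq (b - y + p.-1) p; have := ltn_pmod (b - y + p.-1) p0; lia.
Qed.

Lemma restart_le p y b : (0 < p)%N -> (restart p y b <= maxn y b + p)%N.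
Proof.
move=> p0; rewrite /restart.
have := divn_eq (b - y + p.-1) p; lia.
Qed.

(** * Subadditive passage times on a lattice *)

(** [Y i m n] is the time needed to go from position [m] to position [m + n] when
    leaving at time [i], and [Gm i] is the information available at time [i].
    [Yindep] states at once that the passages starting at time [i] are independent
    of [Gm i] and that their law depends neither on [i] nor on [m]; maxima over
    finite sets of positions cover both single passages and running maxima. *)
Section discrete_process.
Context (d : measure_display) (T : measurableType d) (R : realType).
Context (P : probability T R) (p : nat) (Gm : nat -> set (set T)).
Context (Y : nat -> nat -> nat -> T -> nat).
Context (p_gt0 : (0 < p)%N).
Context (Gm_sigma : forall i, sigma_algebra setT (Gm i)).
Context (Gm_measurable : forall i, Gm i `<=` measurable).
Context (Gm_mono : forall i j, (i <= j)%N -> Gm i `<=` Gm j).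
Context (Ymeas : forall i m n, measurable_fun setT (Y i m n)).
Context (Y_0 : forall w, Y 0 0 0 w = 0%N).
Context (Ysub : forall i m a b w,
  (Y i m (a + b) w <= Y i m a w + Y (i + Y i m a w) (m + a) b w)%N).
Context (Yshift : forall i m n w, (Y i m n w <= Y (i + p) m n w + p)%N).
Context (Ypast : forall n j, Gm j [set w | (Y 0 0 n w <= j)%N]).
Context (Yindep : forall i m (s : seq nat) (A : set nat) B, Gm i B ->
  P (B `&` [set w | A (\max_(n <- s) Y i m n w)%N])
  = (P B * P [set w | A (\max_(n <- s) Y 0 0 n w)%N])%E).
Context (Yint : (mean P (Y 0 0 1) (fun n => n%:R) < +oo)%E).

Let GmE i A : Gm i A = @measurable _ (g_sigma_algebraType (Gm i)) A.
Proof. by rewrite measurable_g_measurableTypeE. Qed.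

Let Gm_setI i A B : Gm i A -> Gm i B -> Gm i (A `&` B).
Proof. rewrite !GmE; exact: measurableI. Qed.

Let Gm_setT i : Gm i setT.
Proof. rewrite GmE; exact: measurableT. Qed.

Let Gm_set0 i : Gm i set0.
Proof. rewrite GmE; exact: measurable0. Qed.

Let Gm_setC i A : Gm i A -> Gm i (~` A).
Proof. rewrite !GmE; exact: measurableC. Qed.

Let Gm_bigcup i (F : nat -> set T) : (forall k, Gm i (F k)) -> Gm i (\bigcup_k F k).
Proof. by move=> GF; rewrite GmE; apply: bigcupT_measurable => k; rewrite -GmE. Qed.

Definition stopping (b : T -> nat) := forall j, Gm j [set w | (b w <= j)%N].

Lemma stopping_eq b y j : stopping b -> (y <= j)%N -> Gm j [set w | b w = y].
Proof.
move=> sb yj; apply: (Gm_mono yj).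
case: y {yj} => [|y].
  rewrite (_ : [set w | b w = 0%N] = [set w | (b w <= 0)%N]) //.
  by apply/seteqP; split=> w /=; lia.
rewrite (_ : [set w | b w = y.+1] =
  [set w | (b w <= y.+1)%N] `&` ~` [set w | (b w <= y)%N]).
  by apply: Gm_setI => //; apply: Gm_setC; apply: (Gm_mono (leqnSn y)).
by apply/seteqP; split=> w /=; lia.
Qed.

Lemma stopping_cst c : stopping (fun=> c).
Proof.
move=> j; case: (leqP c j) => cj.
  by rewrite (_ : [set _ | _] = setT) //; apply/seteqP; split=> w /=.
by rewrite (_ : [set _ | _] = set0) //; apply/seteqP; split=> w //=; lia.
Qed.

Lemma stopping_bigmax (s : seq nat) : stopping (fun w => \max_(n <- s) Y 0 0 n w)%N.
Proof.
move=> j; elim: s => [|n s IHs].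
  by rewrite (_ : [set _ | _] = setT) //; apply/seteqP; split=> w //=; rewrite big_nil.
rewrite (_ : [set _ | _] = [set w | (Y 0 0 n w <= j)%N] `&`
   [set w | (\max_(n <- s) Y 0 0 n w <= j)%N]); first exact: Gm_setI.
by apply/seteqP; split=> w /=; rewrite big_cons geq_max => /andP.
Qed.

(** The restart time is at least [Y 0 0 n w] and [b w], so both are known when it
    has come. *)
Lemma restart_past (Q : nat -> nat -> Prop) n b j : stopping b ->
  Gm j ([set w | Q (Y 0 0 n w) (b w)]
        `&` [set w | restart p (Y 0 0 n w) (b w) = j]).
Proof.
move=> sb.
rewrite (_ : _ `&` _ = \bigcup_y \bigcup_c
  if `[< [/\ (y <= j)%N, (c <= j)%N, Q y c & restart p y c = j] >] then
    [set w | Y 0 0 n w = y] `&` [set w | b w = c] else set0).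
  apply: Gm_bigcup => y; apply: Gm_bigcup => c; case: asboolP => // -[yj cj _ _].
  by apply: Gm_setI; [apply: stopping_eq yj; exact: Ypast|exact: stopping_eq cj].
apply/seteqP; split=> w /=.
  move=> [Qw rw]; exists (Y 0 0 n w) => //; exists (b w) => //.
  rewrite asboolT //; split=> //; rewrite -rw.
    exact: restart_ge.
  exact: restart_ge_level.
by move=> [y _ [c _]]; case: asboolP => // -[_ _ Qw rw] [/= yE cE]; subst y c.
Qed.

(** Strong Markov property: decompose according to the countably many values of
    [rho], and use the independence at each of these deterministic times. *)
Lemma indep_at_random_time (rho : T -> nat) m (s : seq nat) (A : set nat) B :
    (forall j, Gm j (B `&` [set w | rho w = j])) ->
  P (B `&` [set w | A (\max_(n <- s) Y (rho w) m n w)%N])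
  = (P B * P [set w | A (\max_(n <- s) Y 0 0 n w)%N])%E.
Proof.
move=> GB.
have maxmeas i k : measurable [set w | A (\max_(n <- s) Y i k n w)%N].
  exact: (measurable_nat_preimage A
    (measurable_bigmax_nat s (fun n => Ymeas i k n))).
set q := (X in (_ = P B * X)%E).
pose F j := B `&` [set w | rho w = j].
have mF j : measurable (F j) by exact: Gm_measurable (GB j).
have tF : trivIset setT F.
  apply/trivIsetP => i j _ _ ij; apply/seteqP; split=> w //= -[[_ /= wi] [_ /= wj]].
  by move: ij; rewrite -wi -wj eqxx.
have BF : B = \bigcup_j F j.
  apply/seteqP; split=> [w Bw|w [j _ []]//]; by exists (rho w).
pose H j := F j `&` [set w | A (\max_(n <- s) Y j m n w)%N].
have mH j : measurable (H j) by exact: measurableI.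
have tH : trivIset setT H by apply: trivIset_setIr.
have -> : B `&` [set w | A (\max_(n <- s) Y (rho w) m n w)%N] = \bigcup_j H j.
  apply/seteqP; split=> w /=.
    by move=> [Bw Aw]; exists (rho w).
  by move=> [j _ [[Bw /= <-] Aw]].
have q1 : q = (fine q)%:E by rewrite fineK// fin_num_measure//; exact: maxmeas.
rewrite [in RHS]BF !measure_semi_bigcup//; [|exact: bigcup_measurable|exact: bigcup_measurable].
rewrite muleC q1 -nneseriesZl//; apply: eq_eseriesr => j _.
by apply: (etrans (@Yindep j m s A _ (GB j))); rewrite -/q muleC -q1.
Qed.

Lemma restarted_preimage (rho : T -> nat) (D : set (nat -> nat)) m :
  (forall j, measurable [set w | rho w = j]) ->
  (forall j, measurable [set w | D (Y j m ^~ w)]) ->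
  measurable [set w | D (Y (rho w) m ^~ w)].
Proof.
move=> mrho mD.
rewrite (_ : [set w | _] = \bigcup_j ([set w | rho w = j] `&` [set w | D (Y j m ^~ w)])).
  by apply: bigcupT_measurable => j; exact: measurableI.
apply/seteqP; split=> w /= => [Dw|[j _ [<-]]//]; by exists (rho w).
Qed.

Lemma shift_mul i m n k w : (Y i m n w <= Y (i + p * k) m n w + p * k)%N.
Proof.
elim: k => [|k IHk]; first by rewrite muln0 !addn0.
have := Yshift (i + p * k) m n w; rewrite mulnS (_ : i + (p + p * k) = i + p * k + p)%N; lia.
Qed.

(** The restart time differs from the arrival time by a multiple of [p], and
    [Yshift] controls exactly these delays. *)
Lemma restart_passage n k b w : let rho := restart p (Y 0 0 n w) b in
  (Y 0 0 (n + k) w <= rho + Y rho n k w)%N.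
Proof.
rewrite /restart; set q := (_ %/ p)%N => /=.
have := Ysub 0 0 n k w; rewrite !add0n.
have := shift_mul (Y 0 0 n w) n k q w; lia.
Qed.

Lemma random_time_law (rho : T -> nat) m (s : seq nat) (A : set nat) :
    (forall j, Gm j [set w | rho w = j]) ->
  P [set w | A (\max_(n <- s) Y (rho w) m n w)%N]
  = P [set w | A (\max_(n <- s) Y 0 0 n w)%N].
Proof.
move=> Grho; rewrite -[X in P X = _]setTI indep_at_random_time//=.
  by rewrite probability_setT mul1e.
by move=> j; rewrite setTI.
Qed.

Lemma passage_past n (D : set nat) j :
  Gm j ([set w | D (Y 0 0 n w)] `&` [set w | Y 0 0 n w = j]).
Proof.
have [Dj|nDj] := pselect (D j).
  rewrite (_ : _ `&` _ = [set w | Y 0 0 n w = j]); first exact: stopping_eq (Ypast n) (leqnn j).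
  by apply/seteqP; split=> w /= => [[]//|Yj]; rewrite Yj.
by rewrite (_ : _ `&` _ = set0) //; apply/seteqP; split=> w //= [+ Yj]; rewrite Yj.
Qed.

Let Gm_passage n j : Gm j [set w | Y 0 0 n w = j].
Proof. exact: stopping_eq (Ypast n) (leqnn j). Qed.

(** The passage that goes on from [a] at the very time of arrival there. *)
Let fresh a b w := Y (Y 0 0 a w) a b w.

Let m_fresh a b : measurable_fun setT (fresh a b).
Proof.
move=> _ A _; rewrite setTI.
apply: (@restarted_preimage (Y 0 0 a) (fun y => A (y b))) => j.
  exact: Gm_measurable (Gm_passage a j).
exact: (measurable_nat_preimage A (Ymeas j a b)).
Qed.

Let fresh_indep a b (A B : set nat) : P (Y 0 0 a @^-1` A `&` fresh a b @^-1` B)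
  = (P (Y 0 0 a @^-1` A) * P (Y 0 0 b @^-1` B))%E.
Proof.
have := indep_at_random_time a [:: b] B (passage_past a A).
have max1 i m w : (\max_(n <- [:: b]) Y (i w) m n w = Y (i w) m b w)%N by exact: big_seq1.
rewrite (_ : [set w | B (\max_(n <- [:: b]) Y (Y 0 0 a w) a n w)%N]
  = fresh a b @^-1` B); last first.
  by apply/seteqP; split=> w /=; rewrite (max1 (Y 0 0 a)).
move=> ->; congr (_ * P _)%E.
by apply/seteqP; split=> w /=; rewrite (max1 (fun=> 0%N)).
Qed.

Let fresh_law a b (A : set nat) : P (fresh a b @^-1` A) = P (Y 0 0 b @^-1` A).
Proof.
by have := fresh_indep a b setT A; rewrite preimage_setT setTI probability_setT mul1e.
Qed.

Let passage_le a b w : (Y 0 0 (a + b) w <= Y 0 0 a w + fresh a b w)%N.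
Proof. by have := Ysub 0 0 a b w; rewrite !add0n. Qed.

Lemma mean_passageD a b : (mean P (Y 0 0 (a + b)) (fun n => n%:R) <=
  mean P (Y 0 0 a) (fun n => n%:R) + mean P (Y 0 0 b) (fun n => n%:R))%E.
Proof.
apply: le_trans (mean_natD P (Ymeas 0 0 (a + b)) (Ymeas 0 0 a) (m_fresh a b) (passage_le a b)) _.
rewrite leeD2l// le_eqVlt; apply/orP; left; apply/eqP.
by apply: (eq_integral_law (f := fun n => n%:R)) => //; exact: fresh_law.
Qed.

Lemma mean_passage_fin n : mean P (Y 0 0 n) (fun n => n%:R) \is a fin_num.
Proof.
rewrite ge0_fin_numE ?mean_ge0//; elim: n => [|n IHn].
  by rewrite /mean integral0_eq// => w _; rewrite Y_0.
by rewrite -addn1 (le_lt_trans (mean_passageD n 1))// lte_add_pinfty.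
Qed.

Definition mean_passage n : R := fine (mean P (Y 0 0 n) (fun n => n%:R)).

Lemma mean_passage_ge0 n : 0 <= mean_passage n.
Proof. by rewrite fine_ge0// mean_ge0. Qed.

Lemma mean_passage_subadditive a b :
  mean_passage (a + b) <= mean_passage a + mean_passage b.
Proof.
rewrite -lee_fin EFinD /mean_passage !fineK ?mean_passage_fin//.
exact: mean_passageD.
Qed.

Lemma mean_scaled_passage n k :
  mean P (Y 0 0 n) (scaled k) = (mean_passage n / 2 ^+ k)%:E.
Proof.
rewrite EFinM /mean_passage fineK ?mean_passage_fin// muleC -meanZ ?invr_ge0 ?exprn_ge0//.
by apply: eq_integral => w _; rewrite /scaled mulrC.
Qed.

Lemma passage_lower_tail (l x : R) : 0 <= l -> 0 < x ->
    (forall n, l * n%:R <= mean_passage n) ->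
  (\sum_(0 <= k <oo) P [set w | (scaled k (Y 0 0 (2 ^ k) w) <= l - x)%R] < +oo)%E.
Proof.
move=> l0 x0 le.
apply: (@lower_tail_summable _ _ _ P (fun k => Y 0 0 (2 ^ k))
  (fun k => fresh (2 ^ k) (2 ^ k))) => //.
- by move=> k w; rewrite expnS mul2n -addnn; exact: passage_le.
- move=> k; rewrite mean_scaled_passage lee_fin ler_pdivlMr ?exprn_gt0//.
  by have := le (2 ^ k)%N; rewrite natrX.
Qed.

Lemma passage_upper_tail r (L x : R) k0 : 0 <= L -> 0 < x ->
    (forall k, (k0 <= k)%N -> mean_passage (r * 2 ^ k) <= L * (2 ^ k)%N%:R) ->
  (\sum_(0 <= k <oo) P [set w | (L + x <= scaled k (Y 0 0 (r * 2 ^ k) w))%R] < +oo)%E.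
Proof.
move=> L0 x0 le.
apply: (@upper_tail_summable _ _ _ P (fun k => Y 0 0 (r * 2 ^ k))
  (fun k => fresh (r * 2 ^ k) (r * 2 ^ k)) _ _ _ _ _ _ _ k0) => //.
- by move=> k w; rewrite expnS mulnCA mul2n -addnn; exact: passage_le.
- by have := mean_passage_fin (r * 2 ^ 0); rewrite ge0_fin_numE// mean_ge0.
- move=> k k0k; rewrite mean_scaled_passage lee_fin ler_pdivrMr ?exprn_gt0//.
  by have := le k k0k; rewrite natrX.
Qed.

(** The running maximum over the positions up to [2 ^ k].  To double it, restart
    from [2 ^ k] only when all these positions have been reached, so that the
    second half is independent of the first maximum and not only of the arrival
    time at [2 ^ k]. *)
Let upto k := iota 0 (2 ^ k).+1.
Let peak k w := (\max_(n <- upto k) Y 0 0 n w)%N.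
Let late k w := restart p (Y 0 0 (2 ^ k) w) (peak k w).
Let fresh_peak k w := (\max_(n <- upto k) Y (late k w) (2 ^ k) n w)%N.

Let m_max i m (s : seq nat) :
  measurable_fun setT (fun w => \max_(n <- s) Y i m n w)%N.
Proof. exact: measurable_bigmax_nat. Qed.

Let peak_le k n w : (n <= 2 ^ k)%N -> (Y 0 0 n w <= peak k w)%N.
Proof. by move=> nk; apply: leq_bigmax_seq => //; rewrite mem_iota. Qed.

(** The restart costs at most [p] more than the maximum; adding [p] to the maximum
    absorbs this cost. *)
Lemma peak_doubling k w :
  (peak k.+1 w + p <= (peak k w + p) + (fresh_peak k w + p))%N.
Proof.
have lateP : (late k w <= peak k w + p)%N.
  apply: leq_trans (restart_le _ _ p_gt0) _.
  by rewrite leq_add2r geq_max leqnn peak_le.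
rewrite addnA leq_add2r; apply/bigmax_leqP_seq => n; rewrite mem_iota => /andP[_ nk] _.
have [nk2|k2n] := leqP n (2 ^ k); first by rewrite -addnA (leq_trans (peak_le w nk2))// leq_addr.
have := restart_passage (2 ^ k) (n - 2 ^ k) (peak k w) w.
rewrite (subnKC (ltnW k2n)) -/(late k w) => /leq_trans; apply.
apply: leq_add lateP _.
rewrite /fresh_peak; apply: (@leq_bigmax_seq _ _ (fun=> true)
  (fun n => Y (late k w) (2 ^ k) n w)) => //.
by rewrite mem_iota; move: nk; rewrite expnS; lia.
Qed.

(** Only the order of magnitude [2 ^ k] of the maximum matters, so the mean at scale
    0 serves as the bound [L] in [upper_tail_summable]. *)
Lemma peak_tail : exists A : R, 0 <= A /\
  (\sum_(0 <= k <oo) P [set w | (A * (2 ^ k)%N%:R <= (peak k w)%:R)%R] < +oo)%E.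
Proof.
pose V k w := (peak k w + p)%N; pose W k w := (fresh_peak k w + p)%N.
have mV k : measurable_fun setT (V k).
  by apply: measurable_fun_addn => //; exact: m_max.
have late_past k j : Gm j [set w | late k w = j].
  have := @restart_past (fun _ _ => True) (2 ^ k) (peak k) j (stopping_bigmax _).
  by rewrite (_ : [set w | True] = setT) ?setTI//; apply/seteqP; split.
have mW k : measurable_fun setT (W k).
  move=> _ A _; rewrite setTI.
  apply: (@restarted_preimage (late k)
    (fun y => A (\max_(n <- upto k) y n + p)%N)) => j.
    exact: Gm_measurable (late_past k j).
  exact: (measurable_nat_preimage [set v | A (v + p)%N] (m_max j (2 ^ k) (upto k))).
have lawW k A : P (W k @^-1` A) = P (V k @^-1` A).
  exact: (random_time_law (2 ^ k) (upto k) [set v | A (v + p)%N] (late_past k)).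
have indVW k A B : P (V k @^-1` A `&` W k @^-1` B) = (P (V k @^-1` A) * P (V k @^-1` B))%E.
  apply: (indep_at_random_time (rho := late k) (2 ^ k) (upto k) [set v | B (v + p)%N]
     (B := V k @^-1` A)) => j.
  exact: (@restart_past (fun _ c => A (c + p)%N) (2 ^ k) (peak k) j (stopping_bigmax _)).
have VW k w : (V k.+1 w <= V k w + W k w)%N by exact: peak_doubling.
have V0fin : (mean P (V 0%N) (fun n => n%:R) < +oo)%E.
  apply: (@le_lt_trans _ _ (mean P (Y 0 0 1) (fun n => n%:R + p%:R)%R)).
    apply: ge0_le_integral => //.
    - exact: (measurable_nat_EFin (fun n => n%:R)).
    - exact: (measurable_nat_EFin (fun n => n%:R + p%:R)).
    move=> w _; rewrite lee_fin -natrD ler_nat leq_add2r.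
    by rewrite /peak /upto expn0 /= !big_cons big_nil Y_0 max0n maxn0.
  by rewrite meanD// mean_cst lte_add_pinfty// ltry.
have [L L0 VL] : exists2 L : R, 0 <= L & mean P (V 0%N) (fun n => n%:R) = L%:E.
  exists (fine (mean P (V 0%N) (fun n => n%:R))); first by rewrite fine_ge0// mean_ge0.
  by rewrite fineK// ge0_fin_numE// mean_ge0.
exists (L + 1); split; first by rewrite addr_ge0.
have sumV := upper_tail_summable mV mW lawW indVW VW L0 (ltr01 : 0 < 1 :> R) V0fin (k0 := 0).
apply: le_lt_trans (sumV _).
  apply: lee_nneseries => // k _; apply: le_measure; rewrite ?inE.
  - exact: (measurable_nat_preimage [set n : nat | (L + 1) * (2 ^ k)%N%:R <= n%:R]
      (m_max 0 0 (upto k))).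
  - exact: (measurable_nat_preimage [set n : nat | L + 1 <= scaled k n] (mV k)).
  move=> w /= Lk; rewrite /scaled ler_pdivlMr ?exprn_gt0// -natrX (le_trans Lk)//.
  by rewrite ler_nat leq_addr.
move=> k _; rewrite -VL; have := doubling_excess_le mV mW lawW indVW VW k (0 : R).
rewrite (_ : excess 0 \o scaled k = scaled k :> (nat -> R)); last first.
  by apply/funext => n; rewrite /= /excess subr0; apply/max_idPl; exact: scaled_ge0.
rewrite (_ : excess 0 \o scaled 0 = (fun n => n%:R) :> (nat -> R))//.
by apply/funext => n; rewrite /= /excess subr0 /scaled expr0 divr1; apply/max_idPl.
Qed.

(** Ottaviani's argument.  At the first [n] in the window with [Y 0 0 n w <= c n],
    restart from [n] at a time close to [c n]: this event is decided by time [c n],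
    so the rest of the way to [N] is independent of it, and with probability at
    least [del] it takes at most [kappa n].  In that case [N] is reached by [a]. *)
Lemma early_arrival (c kappa : nat -> nat) (m N a : nat) (del : R) :
    0 <= del -> {homo c : i j / (i <= j)%N} ->
    (forall n, (m <= n < N)%N -> (c n + p + kappa n <= a)%N) ->
    (forall n, (m <= n < N)%N ->
      (del%:E <= P [set w | (Y 0 0 (N - n) w <= kappa n)%N])%E) ->
  (del%:E * P (\bigcup_(n in [set n | (m <= n < N)%N]) [set w | (Y 0 0 n w <= c n)%N])
   <= P [set w | (Y 0 0 N w <= a)%N])%E.
Proof.
move=> del0 c_mono budget likely.
pose F n := if (m <= n < N)%N then [set w | (Y 0 0 n w <= c n)%N] else set0.
(* [D n]: the first position of the window that is reached early is [n].  The
   monotonicity of [c] makes it an event known at time [c n]. *)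
pose D n := F n `&` ~` (\bigcup_i if (i < n)%N then F i else set0).
have GF n : Gm (c n) (F n) by rewrite /F; case: ifP => // _; exact: Ypast.
have GD n : Gm (c n) (D n).
  apply: Gm_setI => //; apply: Gm_setC; apply: Gm_bigcup => i.
  by case: ifP => // /ltnW /c_mono ci; exact: Gm_mono ci _ (GF i).
have mD n : measurable (D n) by exact: Gm_measurable (GD n).
have FD : \bigcup_(n in [set n | (m <= n < N)%N]) [set w | (Y 0 0 n w <= c n)%N] = \bigcup_n D n.
  apply/seteqP; split=> [w [n nN Yn]|w [n _ []]].
    have exF : exists n, `[< F n w >].
      by exists n; apply/asboolP; rewrite /F; move: nN => /= ->.
    case: (ex_minnP exF) => k /asboolP Fk kmin; exists k => //; split=> // -[i _].
    by case: ifPn => // ik Fi; have /kmin := asboolT Fi; rewrite leqNgt ik.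
  by rewrite /F; case: ifP => // nN Yn _; exists n.
have tD : trivIset setT D.
  apply/trivIsetP => i j _ _; wlog ij : i j / (i < j)%N => [th|_].
    rewrite neq_ltn => /orP[ij|ij]; first by apply: th => //; rewrite neq_ltn ij.
    by rewrite setIC; apply: th => //; rewrite neq_ltn ij.
  apply/seteqP; split=> w //= [[Fi _] [_ /= []]]; exists i => //.
  by rewrite ij.
pose rho n w := restart p (Y 0 0 n w) (c n).
pose H n := [set w | (Y (rho n w) n (N - n) w <= kappa n)%N].
have Grho n j : Gm j [set w | rho n w = j].
  have := @restart_past (fun _ _ => True) n (fun=> c n) j (stopping_cst (c n)).
  by rewrite (_ : [set w | True] = setT) ?setTI//; apply/seteqP; split.
have mH n : measurable (H n).
  apply: (@restarted_preimage (rho n) (fun y => (y (N - n) <= kappa n)%N)) => j.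
    exact: Gm_measurable (Grho n j).
  exact: (measurable_nat_preimage [set v | (v <= kappa n)%N] (Ymeas j n (N - n))).
have PDH n : (P (D n `&` H n) = P (D n) * P [set w | (Y 0 0 (N - n) w <= kappa n)%N])%E.
  have GDrho j : Gm j (D n `&` [set w | rho n w = j]).
    have [cj|jc] := leqP (c n) j; first by apply: Gm_setI => //; exact: Gm_mono cj _ (GD n).
    rewrite (_ : _ `&` _ = set0)//; apply/seteqP; split=> w //= [_ rj].
    by move: jc; rewrite -rj ltnNge restart_ge_level.
  have := indep_at_random_time n [:: N - n]%N [set v | (v <= kappa n)%N] GDrho.
  rewrite (_ : [set w | [set v | (v <= kappa n)%N]
      (\max_(i <- [:: N - n]%N) Y (rho n w) n i w)%N] = H n).
    move=> ->; congr (_ * P _)%E.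
    by apply/seteqP; split=> w /=; rewrite big_seq1.
  by apply/seteqP; split=> w /=; rewrite big_seq1.
rewrite FD measure_semi_bigcup//; last exact: bigcup_measurable.
rewrite -nneseriesZl//.
apply: (@le_trans _ _ (\sum_(0 <= n <oo) P (D n `&` H n))%E).
  apply: lee_nneseries => [n _ _|n _]; first by rewrite mule_ge0.
  rewrite [leRHS]PDH muleC.
  have [nN|nN] := boolP (m <= n < N)%N; first by rewrite lee_wpmul2l// likely.
  have -> : D n = set0 by rewrite /D /F (negbTE nN) set0I.
  by rewrite measure0 mul0e mule_ge0.
have <- : P (\bigcup_n (D n `&` H n)) = (\sum_(0 <= n <oo) P (D n `&` H n))%E.
  apply: measure_semi_bigcup.
  - by move=> n; exact: measurableI.
  - exact: trivIset_setIr.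
  - by apply: bigcup_measurable => n _; exact: measurableI.
apply: le_measure; rewrite ?inE.
- by apply: bigcup_measurable => n _; exact: measurableI.
- exact: (measurable_nat_preimage [set v | (v <= a)%N] (Ymeas 0 0 N)).
move=> w [n _ [[+ _] /= Hn]]; rewrite /F; case: ifPn => //= nN Yn.
have nN' : (n <= N)%N by case/andP: nN => _ /ltnW.
have := restart_passage n (N - n) (c n) w; rewrite (subnKC nN') -/(rho n w) => /leq_trans; apply.
apply: leq_trans (budget n nN); apply: leq_add => //.
by apply: leq_trans (restart_le _ _ p_gt0) _; rewrite leq_add2r geq_max Yn leqnn.
Qed.

Section rate.
Context (l : R) (l_ge0 : 0 <= l).
Context (le_rate : forall n, l * n%:R <= mean_passage n).
Context (rateP : forall x, 0 < x ->
  exists2 K, 0 <= K & forall n, mean_passage n <= (l + x) * n%:R + K).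

(** [r * 2 ^ k] is reached at rate almost [l], and what remains up to [n] costs at
    most [A * 2 ^ k], hence at most [A / r] per step. *)
Lemma limsup_passage (x : R) : 0 < x ->
  {ae P, forall w, exists n0, forall n, (n0 <= n)%N ->
    (Y 0 0 n w)%:R <= (l + x) * n%:R}.
Proof.
move=> x0; pose y := x / 3; have y0 : 0 < y by rewrite divr_gt0.
have [A [A0 peakA]] := peak_tail.
have [K K0 eK] := rateP y0.
pose L (r : nat) : R := r%:R * (l + y) + y.
have L0 r : 0 <= L r by rewrite !addr_ge0// ?mulr_ge0// ?addr_ge0// ltW.
have ae_main : {ae P, forall w, forall r, exists k0, forall k, (k0 <= k)%N ->
    ~ (L r + y <= scaled k (Y 0 0 (r * 2 ^ k) w) :> R)}.
  apply: ae_foralln => r; apply: ae_eventually_not.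
    move=> k; exact: (measurable_nat_preimage [set n : nat | L r + y <= scaled k n]
      (Ymeas 0 0 (r * 2 ^ k))).
  apply: (@passage_upper_tail r (L r) y (Num.truncn (K / y)).+1) => // k kK.
  apply: le_trans (eK _) _; rewrite /L [leRHS]mulrDl natrM mulrA [(l + y) * _]mulrC lerD2l.
  rewrite mulrC -ler_pdivrMr//; apply: ltW; apply: lt_le_trans (truncnS_gt _) _.
  by rewrite ler_nat (leq_trans kK)// ltnW// ltn_expl.
have ae_peak : {ae P, forall w, forall r, exists k0, forall k, (k0 <= k)%N ->
    ~ (A * (2 ^ k)%N%:R <= (\max_(n <- upto k) Y (Y 0 0 (r * 2 ^ k) w) (r * 2 ^ k) n w)%N%:R)}.
  apply: ae_foralln => r; apply: ae_eventually_not.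
    move=> k; apply: (@restarted_preimage (Y 0 0 (r * 2 ^ k))
      (fun u => A * (2 ^ k)%N%:R <= (\max_(n <- upto k) u n)%N%:R)) => j.
      exact: Gm_measurable (Gm_passage _ _).
    exact: (measurable_nat_preimage [set n : nat | A * (2 ^ k)%N%:R <= n%:R]
      (m_max j (r * 2 ^ k) (upto k))).
  apply: le_lt_trans peakA; apply: lee_nneseries => // k _.
  rewrite (@random_time_law (Y 0 0 (r * 2 ^ k)) (r * 2 ^ k) (upto k)
    [set v | A * (2 ^ k)%N%:R <= v%:R] (Gm_passage _)).
  exact: lexx.
apply: filterS2 ae_main ae_peak => w main pk.
have {main} [k1 main] := choice main.
have {pk} [k2 pk] := choice pk.
pose r0 := (Num.truncn ((2 * y + A) / (2 * y))).+1.
pose K' := (\max_(r < 2 * r0) maxn (k1 r) (k2 r))%N.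
exists (r0 * 2 ^ K')%N => n /(dyadic_block (ltn0Sn _)) [r [k [/andP[r0r r2] Kk /andP[rn nr]]]].
have := leq_trans (leq_bigmax (Ordinal r2)) Kk; rewrite geq_max /= => /andP[/main mk /pk pkk].
move/negP: mk; move/negP: pkk; rewrite -!ltNge => pkk mk.
have le1 := passage_le (r * 2 ^ k) (n - r * 2 ^ k) w.
rewrite subnKC// in le1.
have le2 : (fresh (r * 2 ^ k) (n - r * 2 ^ k) w <=
    \max_(n <- upto k) Y (Y 0 0 (r * 2 ^ k) w) (r * 2 ^ k) n w)%N.
  apply: (@leq_bigmax_seq _ _ (fun=> true)
    (fun n => Y (Y 0 0 (r * 2 ^ k) w) (r * 2 ^ k) n w)) => //.
  by rewrite mem_iota /= add0n ltnS leq_subLR; move: nr; rewrite mulSn addnC => /ltnW.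
have le3 : (Y 0 0 n w)%:R <= (Y 0 0 (r * 2 ^ k) w)%:R
    + (\max_(n <- upto k) Y (Y 0 0 (r * 2 ^ k) w) (r * 2 ^ k) n w)%N%:R :> R.
  by rewrite -natrD ler_nat (leq_trans le1)// leq_add2l.
set q : R := (2 ^ k)%N%:R in pkk.
have q0 : 0 < q by rewrite ltr0n expn_gt0.
rewrite /scaled -natrX ltr_pdivrMr// -/q in mk.
have le4 : (r%:R * q) <= n%:R by rewrite -natrM ler_nat.
have le5 : 2 * y + A <= 2 * y * r%:R.
  rewrite [leRHS]mulrC -ler_pdivrMr ?mulr_gt0//; apply: ltW; apply: lt_le_trans (truncnS_gt _) _.
  by rewrite ler_nat.
apply: (@le_trans _ _ ((l + x) * (r%:R * q))); last first.
  by rewrite ler_wpM2l// addr_ge0// ltW.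
have le6 := ler_wpM2r (ltW q0) le5.
apply: le_trans le3 _; apply: (le_trans (lerD (ltW mk) (ltW pkk))).
rewrite /L; have -> : x = 3 * y by rewrite /y; lra.
lra.
Qed.

(** Markov's inequality for the complementary event. *)
Lemma markov_below (j : nat) (a b : R) : 0 <= a -> 0 < b -> mean_passage j + a <= b ->
  ((a / b)%:E <= P [set w | ((Y 0 0 j w)%:R <= b)%R])%E.
Proof.
move=> a0 b0 ab.
have bn0 (n : nat) : 0 <= b * (n%:R <= b)%R%:R by rewrite mulr_ge0// ltW.
have : (mean P (Y 0 0 j) (fun=> b) <= mean P (Y 0 0 j)
    (fun n => n%:R + b * (n%:R <= b)%R%:R)%R)%E.
  apply: mean_le => // n; first exact: ltW.
  by case: (leP n%:R b) => /= h; rewrite ?mulr1 ?lerDr// mulr0 addr0 ltW.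
rewrite mean_cst meanD// meanZ//; last exact: ltW.
rewrite (mean_pred P (fun n : nat => n%:R <= b))// -[mean _ _ _]fineK ?mean_passage_fin//.
have fP : P [set w | (Y 0 0 j w)%:R <= b] \is a fin_num.
  apply: fin_num_measure.
  exact: (measurable_nat_preimage [set n : nat | n%:R <= b] (Ymeas 0 0 j)).
rewrite -(fineK fP) -/(mean_passage j) -EFinM -EFinD !lee_fin ler_pdivrMr// => h.
lra.
Qed.

(** In the window [2 ^ k, 2 ^ k.+1[, [early_arrival] compares the probability of one
    early position with the lower tail at [2 ^ k.+1]. *)
Lemma liminf_passage (x : R) : 0 < x ->
  {ae P, forall w, exists n0, forall n, (n0 <= n)%N ->
    (l - x) * n%:R <= (Y 0 0 n w)%:R}.
Proof.
move=> x0; have [z0|z0] := leP (l - x) 0.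
  by apply: aeW => w; exists 0%N => n _; rewrite (le_trans (mulr_le0_ge0 z0 _)).
(* Arriving at rate [l - 8 y] in the window, then going on at rate [l + y] with a
   slack [y * m], gains more than [4 y * m] in total on [l * (2 * m)] once [m]
   exceeds [p / y]: the rate at [2 * m] is below [l - 2 * y]. *)
pose y := x / 8; have y0 : 0 < y by rewrite divr_gt0.
have xy : x = 8 * y by rewrite /y; lra.
have [K K0 eK] := rateP y0.
pose c (n : nat) := Num.truncn ((l - x) * n%:R).
pose bnd (m n : nat) : R := (l + y) * (2 * m - n)%N%:R + y * m%:R.
pose del := y / 2 / (l + 2 * y).
have del0 : 0 < del by rewrite !divr_gt0// ltr_wpDl// mulr_gt0.
pose k1 := (Num.truncn ((2 * K + p%:R) / y)).+1.
pose window k := \bigcup_(n in [set n | (2 ^ k <= n < 2 * 2 ^ k)%N])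
  [set w | (Y 0 0 n w <= c n)%N].
have mwindow k : measurable (window k).
  apply: bigcup_measurable => n _.
  exact: (measurable_nat_preimage [set v | (v <= c n)%N] (Ymeas 0 0 n)).
have window_le k : (k1 <= k)%N -> (del%:E * P (window k)
    <= P [set w | (scaled k.+1 (Y 0 0 (2 ^ k.+1) w) <= l - 2 * y)%R])%E.
  move=> kk1; set m := (2 ^ k)%N.
  have Km : 2 * K + p%:R <= y * m%:R.
    rewrite [leRHS]mulrC -ler_pdivrMr//; apply: ltW; apply: lt_le_trans (truncnS_gt _) _.
    by rewrite ler_nat (leq_trans kk1)// ltnW// ltn_expl.
  have m0 : 0 < m%:R :> R by rewrite ltr0n expn_gt0.
  have p0R : 0 <= p%:R :> R by [].
  have bnd0 n : 0 <= bnd m n by rewrite addr_ge0 ?mulr_ge0// ?addr_ge0// ltW.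
  have ly0 : 0 <= (l - 2 * y) * (2 * m)%N%:R by rewrite mulr_ge0//; lra.
  apply: (@le_trans _ _ (P [set w |
      (Y 0 0 (2 * m) w <= Num.truncn ((l - 2 * y) * (2 * m)%N%:R))%N])).
    apply: (@early_arrival c (fun n => Num.truncn (bnd m n))).
    - exact: ltW.
    - by move=> i j ij; apply: le_truncn; rewrite ler_wpM2l ?ler_nat// ltW.
    - move=> n /andP[mn nN]; rewrite truncn_ge_nat// [leLHS]natrD natrD.
      have h1 : (c n)%:R <= (l - x) * n%:R by rewrite truncn_le mulr_ge0// ltW.
      have h2 : (Num.truncn (bnd m n))%:R <= bnd m n by rewrite truncn_le.
      have h3 : (2 * m - n)%N%:R = 2 * m%:R - n%:R :> R by rewrite natrB ?natrM// ltnW.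
      have h4 : y * m%:R <= y * n%:R by rewrite ler_wpM2l ?ler_nat// ltW.
      move: h2; rewrite /bnd h3 natrM; move: h1; rewrite xy => h1 h2; lra.
    - move=> n /andP[mn nN]; rewrite (_ : [set w | _]
          = [set w | (Y 0 0 (2 * m - n) w)%:R <= bnd m n]); last first.
        by apply/seteqP; split=> w /=; rewrite truncn_ge_nat.
      have jm : (2 * m - n)%N%:R <= m%:R :> R by rewrite ler_nat leq_subLR mul2n -addnn leq_add2r.
      have lyj : (l + y) * (2 * m - n)%N%:R <= (l + y) * m%:R.
        by rewrite ler_wpM2l// addr_ge0// ltW.
      have b0 : 0 < bnd m n.
        by rewrite ltr_wpDl ?mulr_gt0// mulr_ge0// addr_ge0// ltW.
      apply: le_trans (@markov_below _ (y / 2 * m%:R) (bnd m n) _ b0 _); last first.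
      + by have := eK (2 * m - n)%N; rewrite /bnd; lra.
      + by rewrite mulr_ge0// divr_ge0// ltW.
      have ly20 : 0 < l + 2 * y by rewrite ltr_wpDl// mulr_gt0.
      have y2 : 0 <= y / 2 by rewrite ltW// divr_gt0.
      rewrite lee_fin /del -[leRHS]mulrA ler_wpM2l//.
      rewrite ler_pdivlMr// mulrC ler_pdivrMr//.
      by rewrite /bnd; lra.
  apply: le_measure; rewrite ?inE.
  - exact: (measurable_nat_preimage [set v | (v <= _)%N] (Ymeas 0 0 (2 * m))).
  - exact: (measurable_nat_preimage [set v | scaled k.+1 v <= l - 2 * y] (Ymeas 0 0 (2 ^ k.+1))).
  move=> w /=; rewrite truncn_ge_nat// /scaled ler_pdivrMr ?exprn_gt0//.
  by rewrite -natrX expnS.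
pose F k := if (k1 < k)%N then window k.-1 else set0.
have mF k : measurable (F k) by rewrite /F; case: ifP.
have FS : (\sum_(0 <= k <oo) P (F k) < +oo)%E.
  have y20 : 0 < 2 * y by rewrite mulr_gt0.
  have low := passage_lower_tail l_ge0 y20 le_rate.
  have low0 k : (0 <= P [set w | (scaled k (Y 0 0 (2 ^ k) w) <= l - 2 * y)%R])%E by [].
  apply: (@le_lt_trans _ _ (del^-1%:E * \sum_(0 <= k <oo)
      P [set w | (scaled k (Y 0 0 (2 ^ k) w) <= l - 2 * y)%R])%E); last first.
    by rewrite lte_mul_pinfty// ?lee_fin ?invr_ge0 ?(ltW del0)//.
  rewrite -nneseriesZl//; apply: lee_nneseries => // k _.
  rewrite lee_pdivlMl// /F; case: k => [|k]; first by rewrite ltn0 measure0 mule0.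
  by case: ltnP => [kk|_]; [exact: window_le|rewrite measure0 mule0].
apply: filterS (ae_eventually_not mF FS) => w [k0 nF].
exists (2 ^ maxn k0 k1)%N => n Kn.
have n0 : (0 < n)%N by apply: leq_trans Kn; rewrite expn_gt0.
have /andP[kn nk] := trunc_log_bounds (isT : 1 < 2)%N n0.
have := trunc_log_max (isT : 1 < 2)%N Kn; rewrite geq_max => /andP[k0n k1n].
have := nF _ (leqW k0n); rewrite /F ltnS k1n /= => nw.
rewrite leNgt; apply/negP => Yn; apply: nw; exists n; first by rewrite /= kn -expnS.
by rewrite /= truncn_ge_nat ?mulr_ge0// ltW.
Qed.

End rate.

Theorem discrete_rate : exists l : R,
  [/\ {ae P, forall w, (Y 0 0 n w)%:R / n%:R @[n --> \oo] --> l},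
      mean_passage n / n%:R @[n --> \oo] --> l
    & forall n, l * n%:R <= mean_passage n].
Proof.
have [l [l0 le_l rate]] := subadditive_rate mean_passage_ge0 mean_passage_subadditive.
exists l; split => //.
  have up : {ae P, forall w, forall i, exists n0, forall n, (n0 <= n)%N ->
      (Y 0 0 n w)%:R <= (l + i.+1%:R^-1) * n%:R}.
    by apply: ae_foralln => i; apply: limsup_passage => //; rewrite invr_gt0.
  have lo : {ae P, forall w, forall i, exists n0, forall n, (n0 <= n)%N ->
      (l - i.+1%:R^-1) * n%:R <= (Y 0 0 n w)%:R}.
    by apply: ae_foralln => i; apply: liminf_passage => //; rewrite invr_gt0.
  apply: filterS2 up lo => w up lo; apply: cvg_rate => x x0.
  pose i := Num.truncn x^-1.
  have ix : i.+1%:R^-1 <= x.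
    by rewrite invf_ple ?posrE//; exact: ltW (truncnS_gt _).
  have [n1 h1] := up i; have [n2 h2] := lo i.
  exists (maxn n1 n2) => n; rewrite geq_max => /andP[/h1 u /h2 v].
  apply/andP; split.
    by apply: le_trans v; rewrite ler_wpM2r// lerD2l lerN2.
  by apply: le_trans u _; rewrite ler_wpM2r// lerD2l.
apply: cvg_rate => x x0.
have x20 : 0 < x / 2 by rewrite divr_gt0.
have [K K0 eK] := rate _ x20.
exists (Num.truncn (K / (x / 2))).+1 => n nK; apply/andP; split.
  by apply: le_trans (le_l n); rewrite ler_wpM2r// gerBl ltW.
apply: le_trans (eK n) _.
have : K <= (x / 2) * n%:R.
  rewrite mulrC -ler_pdivrMr//; apply: ltW; apply: lt_le_trans (truncnS_gt _) _.
  by rewrite ler_nat.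
lra.
Qed.

End discrete_process.

(** * Reading times on a lattice *)

Lemma measurable_nat_le (d : measure_display) (T : measurableType d) (f : T -> nat) :
  (forall j, measurable [set w | (f w <= j)%N]) -> measurable_fun setT f.
Proof.
move=> mf _ A _; rewrite setTI.
rewrite (_ : f @^-1` A = \bigcup_(j in A) [set w | f w = j]); last first.
  by apply/seteqP; split=> w /= => [Aw|[j Aj]]; [exists (f w)|rewrite /= => ->].
apply: bigcup_measurable => -[_|j _].
  rewrite (_ : [set w | f w = 0%N] = [set w | (f w <= 0)%N])//.
  by apply/seteqP; split=> w /=; lia.
rewrite (_ : [set w | f w = j.+1] = [set w | (f w <= j.+1)%N] `\` [set w | (f w <= j)%N]).
  exact: measurableD.
by apply/seteqP; split=> w /=; lia.
Qed.

Section ticks.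
Context {R : realType} (h : R) (h_gt0 : 0 < h).

(** The number of steps of length [h] needed to reach [x]; negative [x] are sent to 0
    so that [ticks_le] holds for all reals. *)
Definition ticks (x : R) : nat := `|Num.ceil (Num.max x 0 / h)%R|%N.

Lemma ticks_le x j : (ticks x <= j)%N = (x <= j%:R * h).
Proof.
have x0 : 0 <= Num.max x 0 / h by rewrite divr_ge0 ?(ltW h_gt0)// le_max lexx orbT.
rewrite /ticks -lez_nat gez0_abs ?ceil_ge0 ?(lt_le_trans _ x0)//.
rewrite ceil_le_int ler_pdivrMr// ge_max.
by rewrite mulr_ge0 ?(ltW h_gt0)// andbT.
Qed.

Lemma ticks_ge x : x <= (ticks x)%:R * h.
Proof. by rewrite -ticks_le. Qed.

Lemma ticks_lt x : 0 <= x -> (ticks x)%:R * h < x + h.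
Proof.
move=> x0; have := leqnn (ticks x); case E : (ticks x) => [|j] _.
  by rewrite mul0r ltr_wpDl.
have : ~~ (ticks x <= j)%N by rewrite E ltnn.
by rewrite ticks_le -ltNge -[j.+1]addn1 natrD mulrDl mul1r ltrD2r.
Qed.

(** [u n] stands for the passage time over [n.+1] steps, and [q] for the lag [C] in
    units of [h].  The empty passage takes no time, and carries no lag. *)
Definition reading (q : nat) (u : nat -> R) (n : nat) : nat :=
  if n == 0%N then 0%N else (q + ticks (u n.-1))%N.

Lemma reading_event (T : pointedType) (G : set (set T)) (u : T -> nat -> R)
    (q : nat) (s : seq nat) (A : set nat) : sigma_algebra setT G ->
    (forall n (B : set R), measurable B -> G ((fun w => u w n) @^-1` B)) ->
  G [set w | A (\max_(n <- s) reading q (u w) n)%N].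
Proof.
move=> GS Gu.
have GE B : G B = @measurable _ (g_sigma_algebraType G) B.
  by rewrite measurable_g_measurableTypeE.
rewrite GE.
apply: (@measurable_nat_preimage _ (g_sigma_algebraType G)
  (fun w => \max_(n <- s) reading q (u w) n)%N A).
have mr n : measurable_fun setT (fun w : g_sigma_algebraType G => reading q (u w) n).
  rewrite /reading; case: eqP => _; first exact: measurable_cst.
  apply: measurable_nat_le => j; have [qj|jq] := leqP q j.
    rewrite -GE (_ : [set w | _] = (fun w => u w n.-1) @^-1` `]-oo, (j - q)%N%:R * h]).
      exact: Gu.
    by apply/seteqP; split=> w /=; rewrite in_itv/= -ticks_le; lia.
  rewrite (_ : [set w | _] = set0)//; apply/seteqP; split=> w //=; lia.
exact: measurable_bigmax_nat.
Qed.

End ticks.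

Definition trivial_sigma (T : Type) : set (set T) := [set A | A = set0 \/ A = setT].

Lemma trivial_sigma_algebra (T : Type) : sigma_algebra setT (@trivial_sigma T).
Proof.
split=> [|A [->|->]|A tA]; first by left.
- by right; rewrite setD0.
- by left; rewrite setDv.
have [[i Ai]|nA] := pselect (exists i, A i = setT).
  by right; apply/seteqP; split=> w // _; exists i => //; rewrite Ai.
left; apply/seteqP; split=> w //= [i _]; case: (tA i) => [->//|Ai].
by exfalso; apply: nA; exists i.
Qed.

(** [err] bounds the rounding error; it is [0] in the integer case and [h] otherwise. *)
Section lattice_times.
Context (d : measure_display) (T : measurableType d) (R : realType).
Context (P : probability T R) (Fm Fp : R -> set (set T)).
Context (Fm_sigma : forall t : R, 0 <= t -> sigma_algebra setT (Fm t)).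
Context (Fp_sigma : forall t : R, 0 <= t -> sigma_algebra setT (Fp t)).
Context (Fm_mono : forall s t : R, 0 <= s -> s <= t ->
  Fm s `<=` Fm t /\ Fm t `<=` measurable).
Context (X : R -> nat -> nat -> T -> R).
Context (X_rv : forall (t : R) (m n : nat), 0 <= t -> (m < n)%N ->
  measurable_fun setT (X t m n)).
Context (X_ge0 : forall (t : R) (m n : nat) (w : T), 0 <= t -> (m < n)%N ->
  0 <= X t m n w).
Context (C : R) (C_ge0 : 0 <= C).
Context (H1 : forall (t : R) (m n k : nat) (w : T), 0 <= t -> (m < k)%N ->
  (k < n)%N -> X t m n w <= X t m k w + X (t + X t m k w) k n w).
Context (H2 : ('E_P[X 0%R 0%N 1%N] < +oo)%E).
Context (H3 : forall (t : R) (m : nat) (t' : R) (m' : nat), 0 <= t -> 0 <= t' ->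
  same_joint_distribution P (fun w i => X t m (m + i.+1)%N w)
                            (fun w i => X t' m' (m' + i.+1)%N w)).
Context (H4 : forall (t : R) (m n : nat), 0 <= t -> (m < n)%N ->
  measurable_wrt (Fp t) (X t m n) /\
  (forall s : R, 0 <= s -> Fm (t + s) [set w | X t m n w <= s])).
Context (H5 : forall t : R, 0 <= t -> indep_sigma_algebras P (Fm t) (Fp (t + C))).
Context (h err : R) (q p : nat) (h_gt0 : 0 < h) (qh : q%:R * h = C) (p_gt0 : (0 < p)%N).
Context (shift_p : forall (t : R) (m n : nat) (w : T), 0 <= t -> (m < n)%N ->
  X t m n w <= X (t + p%:R * h) m n w + p%:R * h).
Context (shift_round : forall (t x : R) (m n : nat) (w : T), 0 <= t -> (m < n)%N ->
  (exists t' m' n' w', [/\ 0 <= t', (m' < n')%N & x = X t' m' n' w']) ->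
  let s := C + ((ticks h x)%:R * h - x) in
  X t m n w <= X (t + s) m n w + s).
Context (err_ge0 : 0 <= err).
Context (roundP : forall (t : R) (m n : nat) (w : T), 0 <= t -> (m < n)%N ->
  (ticks h (X t m n w))%:R * h <= X t m n w + err).

Let lag (i : nat) : R := i%:R * h.
Let lag_ge0 i : 0 <= lag i.
Proof. by rewrite /lag mulr_ge0// ltW. Qed.
Let lagD i j : lag (i + j) = lag i + lag j.
Proof. by rewrite /lag natrD mulrDl. Qed.

Let row t m (w : T) (i : nat) := X t m (m + i.+1)%N w.
Let Y i m n w := reading h q (row (lag i) m w) n.

(** The lag contained in [Y] lets the past at lattice time [i] stop at real time
    [lag i - C], which is what the independence hypothesis requires.  Before time
    [C] nothing is known. *)
Let Gm i := if (i < q)%N then @trivial_sigma T else Fm (lag (i - q)).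

Let Gm_sigma i : sigma_algebra setT (Gm i).
Proof.
by rewrite /Gm; case: ifP => _; [exact: trivial_sigma_algebra|exact: Fm_sigma].
Qed.

Let Gm_measurable i : Gm i `<=` measurable.
Proof.
rewrite /Gm; case: ifP => _; first by move=> A [->|->]//; exact: measurableT.
by have [] := Fm_mono (lag_ge0 (i - q)) (lexx _).
Qed.

Let Gm_mono i j : (i <= j)%N -> Gm i `<=` Gm j.
Proof.
move=> ij A GA; have [S0 SC SU] := Gm_sigma j; move: GA; rewrite {1}/Gm.
have [iq|qi] := ltnP i q.
  by move=> [->//|->]; rewrite -(setD0 setT); exact: SC.
rewrite /Gm ltnNge (leq_trans qi ij) /=.
have lij : lag (i - q) <= lag (j - q).
  by rewrite /lag ler_wpM2r ?(ltW h_gt0)// ler_nat leq_sub2r.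
by have [+ _] := Fm_mono (lag_ge0 _) lij; apply.
Qed.

Let row_event t m (G : set (set T)) s (A : set nat) : 0 <= t -> sigma_algebra setT G ->
  Fp t `<=` G -> G [set w | A (\max_(n <- s) reading h q (row t m w) n)%N].
Proof.
move=> t0 GS FG; apply: (@reading_event _ h h_gt0 T G (row t m)) => // n B mB; apply: FG.
have mn : (m < m + n.+1)%N by rewrite addnS ltnS leq_addr.
by have [+ _] := H4 t0 mn; apply.
Qed.

Let row_measurable t m n : 0 <= t -> measurable_fun setT (fun w => row t m w n).
Proof. by move=> t0; apply: X_rv => //; rewrite addnS ltnS leq_addr. Qed.

Let Ymax_measurable i m s (A : set nat) :
  measurable [set w | A (\max_(n <- s) Y i m n w)%N].
Proof.
apply: (@reading_event _ h h_gt0 T measurable (row (lag i) m)).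
  exact: sigma_algebra_measurable.
by move=> n B mB; rewrite -[_ @^-1` _]setTI; apply: row_measurable.
Qed.

Let Ymeas i m n : measurable_fun setT (Y i m n).
Proof.
move=> _ A _; rewrite setTI; have := Ymax_measurable i m [:: n] A.
by congr measurable; apply/seteqP; split=> w /=; rewrite big_seq1.
Qed.

Let Y_law i m s (A : set nat) : P [set w | A (\max_(n <- s) Y i m n w)%N]
  = P [set w | A (\max_(n <- s) Y 0 0 n w)%N].
Proof.
pose S := [set u : nat -> R | A (\max_(n <- s) reading h q u n)%N].
apply: (H3 m 0 (lag_ge0 i) (lag_ge0 0) (A := S)).
apply: (@reading_event _ h h_gt0 (nat -> R) (@sequence_sigma_algebra R) id).
  exact: smallest_sigma_algebra.
move=> n B mB; apply: sub_sigma_algebra; exists n => //; exists B => //.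
by rewrite setTI.
Qed.

Let Yindep i m (s : seq nat) (A : set nat) B : Gm i B ->
  P (B `&` [set w | A (\max_(n <- s) Y i m n w)%N])
  = (P B * P [set w | A (\max_(n <- s) Y 0 0 n w)%N])%E.
Proof.
rewrite -(Y_law i m); rewrite /Gm; case: ltnP => [_|qi].
  by move=> [->|->]; rewrite ?set0I ?measure0 ?mul0e// setTI probability_setT mul1e.
move=> FB; apply: (H5 (lag_ge0 (i - q)) FB).
have -> : lag (i - q) + C = lag i by rewrite -qh -lagD subnK.
exact: row_event (Fp_sigma (lag_ge0 i)) _.
Qed.

Let Ypast n j : Gm j [set w | (Y 0 0 n w <= j)%N].
Proof.
have [S0 SC SU] := Gm_sigma j.
rewrite /Y /reading; case: eqP => [_|n0].
  by rewrite (_ : [set w | _] = setT `\` set0); [exact: SC|rewrite setD0; apply/seteqP].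
rewrite /Gm; case: ltnP => [jq|qj].
  left; apply/seteqP; split=> w //=; lia.
have [//|_] := @H4 (lag 0) 0 n.-1.+1 (lag_ge0 0).
move=> /(_ (lag (j - q)) (lag_ge0 _)).
rewrite {1}/lag mul0r add0r; congr (Fm _ _).
apply/seteqP; split=> w /=; rewrite -ticks_le// /row add0n; lia.
Qed.

Let Yshift i m n w : (Y i m n w <= Y (i + p) m n w + p)%N.
Proof.
rewrite /Y /reading; case: eqP => // n0; rewrite -addnA leq_add2l ticks_le//.
have mn : (m < m + n.-1.+1)%N by rewrite addnS ltnS leq_addr.
apply: le_trans (shift_p w (lag_ge0 i) mn) _.
rewrite natrD mulrDl lerD2r -/(lag p) -lagD.
exact: (ticks_ge h_gt0).
Qed.

(** The departure at the rounded time is later than the arrival by the lag [C] plus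
    the rounding error: a delay of the kind covered by [shift_round]. *)
Let Ysub i m a b w :
  (Y i m (a + b) w <= Y i m a w + Y (i + Y i m a w) (m + a) b w)%N.
Proof.
case: a => [|a]; first by rewrite /Y /reading /= !addn0.
case: b => [|b]; first by rewrite addn0 leq_addr.
have mn (k n : nat) : (k < k + n.+1)%N by rewrite addnS ltnS leq_addr.
have YS i' m' n : Y i' m' n.+1 w = (q + ticks h (X (lag i') m' (m' + n.+1) w))%N by [].
set j := (i + _)%N; rewrite addSn !YS.
rewrite (_ : m + (a + b.+1).+1 = m + a.+1 + b.+1)%N; last by rewrite -addSn addnA.
rewrite -[leqRHS]addnA leq_add2l ticks_le//.
set Xa := X (lag i) m (m + a.+1) w.
have Xa0 : 0 <= Xa by apply: X_ge0.
have t0 : 0 <= lag i + Xa by rewrite addr_ge0.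
have h1 := H1 w (lag_ge0 i) (mn m a) (mn (m + a.+1)%N b).
have h2 := @shift_round (lag i + Xa) Xa (m + a.+1)%N (m + a.+1 + b.+1)%N w t0 (mn _ _)
  (ex_intro _ (lag i) (ex_intro _ m (ex_intro _ (m + a.+1)%N
    (ex_intro _ w (And3 (lag_ge0 i) (mn _ _) erefl))))).
move: h2 => /=; have -> : lag i + Xa + (C + ((ticks h Xa)%:R * h - Xa)) = lag j.
  by rewrite /j YS !lagD -qh /lag; lra.
have h3 := ticks_ge h_gt0 (X (lag j) (m + a.+1) (m + a.+1 + b.+1) w).
move=> h2; apply: (le_trans h1); rewrite -/Xa !natrD !mulrDl qh; lra.
Qed.

Let Y_at0 n w : (0 < n)%N -> Y 0 0 n w = (q + ticks h (X 0 0 n w))%N.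
Proof. by case: n => // n _; rewrite /Y /reading /row /lag mul0r add0n. Qed.

Let Y_bounds n w : (0 < n)%N ->
  X 0 0 n w + C <= h * (Y 0 0 n w)%:R <= X 0 0 n w + (C + err).
Proof.
move=> n0; rewrite Y_at0// natrD mulrDr mulrC qh [h * _]mulrC.
have h1 := ticks_ge h_gt0 (X 0 0 n w); have h2 := roundP w (lexx 0) n0.
apply/andP; split; lra.
Qed.

Let mean_bounds n : (0 < n)%N ->
  ('E_P[X 0%R 0%N n] + C%:E <= h%:E * mean P (Y 0 0 n) (fun n => n%:R))%E
  /\ (h%:E * mean P (Y 0 0 n) (fun n => n%:R) <= 'E_P[X 0%R 0%N n] + (C + err)%:E)%E.
Proof.
move=> n0.
have mX : measurable_fun setT (fun w => (X 0 0 n w)%:E).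
  by apply/measurable_EFinP; exact: X_rv.
have X0 w : setT w -> (0 <= (X 0 0 n w)%:E)%E by rewrite lee_fin X_ge0.
have addc c : 0 <= c -> ('E_P[X 0%R 0%N n] + c%:E = \int[P]_w ((X 0 0 n w)%:E + c%:E))%E.
  move=> c0; rewrite ge0_integralD//.
  by rewrite integral_cst//= probability_setT mule1 unlock.
have mY : measurable_fun setT (fun w => (h * (Y 0 0 n w)%:R)%:E).
  exact: (measurable_nat_EFin (fun n => h * n%:R)).
rewrite -meanZ//; last exact: ltW.
rewrite addc// addc ?addr_ge0//; split; apply: ge0_le_integral => //.
- by move=> w _; rewrite adde_ge0 ?X0// lee_fin.
- by apply: emeasurable_funD.
- by move=> w _; rewrite -EFinD lee_fin; have /andP[] := Y_bounds w n0.
- by move=> w _; rewrite lee_fin mulr_ge0// ltW.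
- by apply: emeasurable_funD.
- by move=> w _; rewrite -EFinD lee_fin; have /andP[] := Y_bounds w n0.
Qed.

Let Yint : (mean P (Y 0 0 1) (fun n => n%:R) < +oo)%E.
Proof.
have [_ le1] := mean_bounds (ltn0Sn 0).
apply: (@le_lt_trans _ _ (h^-1%:E * ('E_P[X 0%R 0%N 1%N] + (C + err)%:E))%E).
  by rewrite lee_pdivlMl.
by rewrite lte_mul_pinfty ?lee_fin ?invr_ge0 ?(ltW h_gt0)// lte_add_pinfty// ltry.
Qed.

(** The rate [l] is that of [X], and so does not depend on the mesh; this is what
    allows [err] to tend to 0. *)
Theorem lattice_rate : exists l : R,
  [/\ {ae P, forall w, X 0 0%N n w / n%:R @[n --> \oo] --> l},
      forall n, (0 < n)%N -> ('E_P[X 0%R 0%N n])%E \is a fin_num,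
      fine ('E_P[X 0%R 0%N n])%E / n%:R @[n --> \oo] --> l
    & forall n, (0 < n)%N -> l * n%:R <= fine ('E_P[X 0%R 0%N n])%E + C + err].
Proof.
have Y_0 w : Y 0 0 0 w = 0%N by [].
have fin_e n : mean P (Y 0 0 n) (fun n => n%:R) = (mean_passage P Y n)%:E.
  by rewrite fineK// (mean_passage_fin p_gt0 Gm_sigma Gm_measurable Gm_mono Ymeas).
have finE n : (0 < n)%N -> ('E_P[X 0%R 0%N n])%E \is a fin_num.
  move=> n0; have [+ _] := mean_bounds n0; rewrite fin_e => le1.
  rewrite ge0_fin_numE; last by apply: expectation_ge0 => w; exact: X_ge0.
  apply: le_lt_trans (ltry (h * mean_passage P Y n)).
  by apply: le_trans le1; rewrite leeDl// lee_fin.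
have bounds n : (0 < n)%N -> fine ('E_P[X 0%R 0%N n])%E + C <= h * mean_passage P Y n
    <= fine ('E_P[X 0%R 0%N n])%E + (C + err).
  move=> n0; have := mean_bounds n0; rewrite fin_e -(fineK (finE n n0)).
  by rewrite -!EFinD -EFinM !lee_fin /= => -[-> ->].
have [l [ae_l mean_l le_l]] := discrete_rate p_gt0 Gm_sigma Gm_measurable Gm_mono
  Ymeas Y_0 Ysub Yshift Ypast Yindep Yint.
exists (h * l); split => //.
- apply: filterS ae_l => w; apply: cvg_rate_affine => // n n0.
  exact: Y_bounds.
- exact: cvg_rate_affine h_gt0 bounds mean_l.
- move=> n n0; have /andP[_ le1] := bounds n n0.
  by rewrite -mulrA -addrA (le_trans _ le1)// ler_wpM2l// ltW.
Qed.

End lattice_times.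

(** * From the rate to the infimum *)

Lemma limit_conclusion_of_rate (d : measure_display) (T : measurableType d)
    (R : realType) (P : probability T R) (Y : nat -> T -> R) (C l : R) :
    {ae P, forall w, Y n w / n%:R @[n --> \oo] --> l} ->
    (forall n, (0 < n)%N -> ('E_P[Y n])%E \is a fin_num) ->
    fine ('E_P[Y n])%E / n%:R @[n --> \oo] --> l ->
    (forall n, (0 < n)%N -> l * n%:R <= fine ('E_P[Y n])%E + C) ->
  limit_conclusion P Y C.
Proof.
move=> ae_l finE mean_l le_l; exists l; split=> //.
  apply/fine_cvgP; split.
    by exists 1%N => // n /= n1; rewrite fin_numM// finE.
  apply: cvg_trans mean_l; apply: near_eq_cvg.
  by exists 1%N => // n /= n1; rewrite fineM// finE.
have EQ n : (0 < n)%N -> (('E_P[Y n] + C%:E) * (n%:R^-1)%:E)%E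
    = ((fine ('E_P[Y n])%E + C) / n%:R)%:E.
  by move=> n0; rewrite -{1}(fineK (finE n n0)) -EFinD -EFinM.
apply/eqP; rewrite eq_le; apply/andP; split.
  apply: le_ereal_inf_tmp => _ [n /= n0 <-]; rewrite EQ// lee_fin.
  by rewrite ler_pdivlMr ?ltr0n// le_l.
apply/lee_addgt0Pr => e e0.
have : (fine ('E_P[Y n])%E + C) / n%:R @[n --> \oo] --> l.
  have h1 : 0 < 1 :> R by [].
  rewrite -[l]mul1r; apply: (@cvg_rate_affine _
    (fun n => fine ('E_P[Y n])%E) _ 1 (- C) (- C)) => // n _.
  by rewrite addrK mul1r lexx.
move=> /cvgrPdist_le /(_ e e0) [N _ /(_ (maxn N 1))] /=; rewrite leq_maxl => /(_ isT).
set n := maxn N 1; have n0 : (0 < n)%N by rewrite leq_max orbT.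
rewrite distrC ler_distl => /andP[_ le].
rewrite -EFinD; apply: (@le_trans _ _ ((fine ('E_P[Y n])%E + C) / n%:R)%:E).
  by apply: ereal_inf_lbound; exists n => //; rewrite EQ.
by rewrite lee_fin.
Qed.

Theorem theorem1p1 (d : measure_display) (T : measurableType d)
    (R : realType) (P : probability T R)
    (Fm Fp : R -> set (set T))
    (Fm_sigma : forall t : R, 0 <= t -> sigma_algebra setT (Fm t))
    (Fp_sigma : forall t : R, 0 <= t -> sigma_algebra setT (Fp t))
    (Fm_mono : forall s t : R, 0 <= s -> s <= t ->
       Fm s `<=` Fm t /\ Fm t `<=` measurable)
    (Fp_anti : forall s t : R, 0 <= s -> s <= t ->
       Fp s `<=` measurable /\ Fp t `<=` Fp s)
    (X : R -> nat -> nat -> T -> R)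
    (X_rv : forall (t : R) (m n : nat), 0 <= t -> (m < n)%N -> measurable_fun setT (X t m n))
    (X_ge0 : forall (t : R) (m n : nat) (w : T), 0 <= t -> (m < n)%N -> 0 <= X t m n w)
    (C : R) (C_ge0 : 0 <= C)
    (H1 : forall (t : R) (m n k : nat) (w : T), 0 <= t -> (m < k)%N -> (k < n)%N ->
       X t m n w <= X t m k w + X (t + X t m k w) k n w)
    (H2 : ('E_P[X 0%R 0%N 1%N] < +oo)%E)
    (H3 : forall (t : R) (m : nat) (t' : R) (m' : nat), 0 <= t -> 0 <= t' ->
       same_joint_distribution P (fun w i => X t m (m + i.+1)%N w)
                                 (fun w i => X t' m' (m' + i.+1)%N w))
    (H4 : forall (t : R) (m n : nat), 0 <= t -> (m < n)%N ->
       measurable_wrt (Fp t) (X t m n) /\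
       (forall s : R, 0 <= s -> Fm (t + s) [set w | X t m n w <= s]))
    (H5 : forall t : R, 0 <= t -> indep_sigma_algebras P (Fm t) (Fp (t + C))) :
  ((exists2 c : R, 0 < c & time_shift_bound X C c) ->
     limit_conclusion P (fun n => X 0 0%N n) C) /\
  ((exists2 k : nat, (0 < k)%N & C = k%:R) ->
   (forall (t : R) (m n : nat) (w : T), 0 <= t -> (m < n)%N -> X t m n w \is a Num.int) ->
   time_shift_bound X C 0 ->
     limit_conclusion P (fun n => X 0 0%N n) C).
Proof.
have rate := @lattice_rate d T R P Fm Fp Fm_sigma Fp_sigma Fm_mono X X_rv X_ge0
  C C_ge0 H1 H2 H3 H4 H5.
split=> [[c c0 shift]|[k k0 Ck] Xint shift]; last first.
  have ticksX t m n w : 0 <= t -> (m < n)%N -> (ticks 1 (X t m n w))%:R = X t m n w.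
    move=> t0 mn; have := Xint t m n w t0 mn; have := X_ge0 t m n w t0 mn.
    move: (X t m n w) => x x0 xint.
    have [j ->] : exists j : nat, x = j%:R by apply/natrP; rewrite natrEint xint.
    congr (_%:R); apply/eqP; rewrite eqn_leq ticks_le// mulr1 lexx/=.
    by rewrite -(ler_nat R) -[leRHS]mulr1 ticks_ge.
  have shiftC t m n w : 0 <= t -> (m < n)%N -> X t m n w <= X (t + C) m n w + C.
    by move=> t0 mn; apply: shift => //; rewrite addr0 lexx.
  have [|t m n w t0 mn|t x m n w t0 mn [t' [m' [n' [w' [t'0 mn' ->]]]]]|t m n w t0 mn|
      l [ae_l finE mean_l le_l]] := rate 1 0 k k ltr01 _ k0 _ _ (lexx 0) _.
  - by rewrite mulr1.
  - by rewrite mulr1 -Ck; exact: shiftC.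
  - by rewrite mulr1 ticksX// subrr addr0; exact: shiftC.
  - by rewrite mulr1 addr0 ticksX.
  apply: (limit_conclusion_of_rate ae_l finE mean_l) => n n0.
  by rewrite (le_trans (le_l n n0))// addr0.
have fine_lattice (e : R) : 0 < e -> exists l : R,
    [/\ {ae P, forall w, X 0 0%N n w / n%:R @[n --> \oo] --> l},
        forall n, (0 < n)%N -> ('E_P[X 0%R 0%N n])%E \is a fin_num,
        fine ('E_P[X 0%R 0%N n])%E / n%:R @[n --> \oo] --> l
      & forall n, (0 < n)%N -> l * n%:R <= fine ('E_P[X 0%R 0%N n])%E + C + e].
  move=> e0.
  (* [C] must be a multiple of the mesh.  If [C] is 0 then [q] is 0, and the period
     has to be chosen apart, since it must be positive. *)
  have [h [q [p [h0 hc he qh [p0 ph]]]]] : exists h q p, [/\ 0 < h, h <= c, h <= e,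
      q%:R * h = C & (0 < p)%N /\ C <= p%:R * h <= C + c].
    have ce0 : 0 < Num.min c e by rewrite lt_min c0 e0.
    have [C0|C0] := eqVneq C 0.
      exists (Num.min c e), 0%N, 1%N; split=> //.
      - by rewrite ge_min lexx.
      - by rewrite ge_min lexx orbT.
      - by rewrite mul0r C0.
      - by rewrite C0 mul1r add0r ltW// ge_min lexx.
    have Cp : 0 < C by rewrite lt0r C0.
    pose q := (Num.truncn (C / Num.min c e)).+1.
    have q0 : 0 < q%:R :> R by rewrite ltr0n.
    have qC : q%:R * (C / q%:R) = C by rewrite mulrC divfK// gt_eqF.
    have hce : C / q%:R <= Num.min c e.
      by rewrite ler_pdivrMr// mulrC -ler_pdivrMr//; exact: ltW (truncnS_gt _).
    move: (hce); rewrite le_min => /andP[hc he].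
    exists (C / q%:R), q, q; split=> //; first by rewrite divr_gt0.
    by rewrite qC lexx lerDl ltW.
  have ticksX t m n w : 0 <= t -> (m < n)%N ->
      X t m n w <= (ticks h (X t m n w))%:R * h < X t m n w + h.
    by move=> t0 mn; rewrite ticks_ge// ticks_lt// X_ge0.
  have [t m n w t0 mn|t x m n w t0 mn [t' [m' [n' [w' [t'0 mn' ->]]]]]|t m n w t0 mn|
      l [ae_l finE mean_l le_l]] := rate h h q p h0 qh p0 _ _ (ltW h0) _.
  - exact: shift.
  - apply: shift => //; have := ticksX t' m' n' w' t'0 mn' => /andP[h1 h2].
    by apply/andP; split; lra.
  - by have /andP[_ /ltW] := ticksX t m n w t0 mn.
  exists l; split=> // n n0; apply: le_trans (le_l n n0) _; by rewrite lerD2l.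
have [l [ae_l finE mean_l _]] := fine_lattice 1 ltr01.
apply: (limit_conclusion_of_rate ae_l finE mean_l) => n n0.
apply/ler_addgt0Pr => e e0; have [l' [_ _ mean_l' le_l']] := fine_lattice e e0.
by rewrite (cvg_unique _ mean_l mean_l')//; exact: le_l'.
Qed.
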